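(* In the word-RAM model with $O(\log m)$-bit words, assuming the $k$-Cycle Hypothesis, there is no constant $\varepsilon>0$ such that incremental $s$-$t$ Shortest Path in directed or undirected $m$-edge graphs can be solved with $O(m^{2-\varepsilon})$ preprocessing time and $O(m^{1-\varepsilon})$ amortized update and query time.
   Context: $k$-Cycle Hypothesis: in the word-RAM model with $O(\log m)$-bit words, for every constant $\varepsilon>0$ there exists a constant integer $k$ such that there is no $O(m^{2-\varepsilon})$ time algorithm that detects whether an $m$-edge graph contains a cycle on $k$ vertices. In incremental $s$-$t$ Shortest Path, one starts from a graph (initially empty) that undergoes only edge insertions, two vertices $s,t$ are fixed, and queries ask for the current (unweighted) shortest-path distance from $s$ to $t$. *)

(* Defs.v *)
From Stdlib Require Import Reals List Arith.
Import ListNotations.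

Set Implicit Arguments.

(* A deterministic word RAM with [w]-bit words: a program is a finite list of
   instructions, it can name a constant number of registers, and it addresses
   a random-access memory through registers.  Every instruction costs one
   step, and the machine halts when the program counter leaves the program. *)

Inductive binop : Set :=
  | Add | Sub | Mul | Div | Mod
  | And | Or | Xor | Shl | Shr
  | Lt | Eq.

(* Words are naturals below [2 ^ w]; [Add], [Sub], [Mul], [Shl] wrap around,
   and [a / 0] is [0], [a mod 0] is [a]. *)
Definition eval_binop (w : nat) (o : binop) (a b : nat) : nat :=
  (match o with
   | Add => a + b
   | Sub => a + 2 ^ w - b
   | Mul => a * b
   | Div => a / b
   | Mod => a mod b
   | And => Nat.land a b
   | Or => Nat.lor a b
   | Xor => Nat.lxor a b
   | Shl => Nat.shiftl a b
   | Shr => Nat.shiftr a b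
   | Lt => if a <? b then 1 else 0
   | Eq => if a =? b then 1 else 0
   end) mod 2 ^ w.

Inductive instr : Set :=
  | Const (r : nat) (x : nat)
  | Op (o : binop) (r r1 r2 : nat)
  | Fetch (r ra : nat)
  | Store (ra r : nat)
  | Jump (l : nat)
  | JumpZ (r l : nat).

Definition program : Set := list instr.

Record state : Set := State {
  pc : nat;
  reg : nat -> nat;
  mem : nat -> nat
}.

Definition upd (f : nat -> nat) (a x : nat) : nat -> nat :=
  fun b => if b =? a then x else f b.

Definition exec_instr (w : nat) (i : instr) (st : state) : state :=
  match i with
  | Const r x => State (S (pc st)) (upd (reg st) r (x mod 2 ^ w)) (mem st)
  | Op o r r1 r2 =>
      State (S (pc st))
        (upd (reg st) r (eval_binop w o (reg st r1) (reg st r2))) (mem st)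
  | Fetch r ra =>
      State (S (pc st)) (upd (reg st) r (mem st (reg st ra))) (mem st)
  | Store ra r =>
      State (S (pc st)) (reg st) (upd (mem st) (reg st ra) (reg st r))
  | Jump l => State l (reg st) (mem st)
  | JumpZ r l =>
      State (if reg st r =? 0 then l else S (pc st)) (reg st) (mem st)
  end.

(* [halts_in w P st T st']: started in [st], the program [P] halts after
   exactly [T] steps, in the state [st']. *)
Inductive halts_in (w : nat) (P : program) : state -> nat -> state -> Prop :=
  | halts_now st :
      nth_error P (pc st) = None -> halts_in w P st 0 st
  | halts_step st i T st' :
      nth_error P (pc st) = Some i ->
      halts_in w P (exec_instr w i st) T st' ->
      halts_in w P st (S T) st'.

(* The word size, [O(log m)] bits with the constant [c] chosen by the
   algorithm.  For [1 <= c] all numbers up to [2 * m] fit in a word; these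
   include the vertex names and the addresses occupied by an input. *)
Definition word_size (c m : nat) : nat := c * (Nat.log2 m + 2).

Inductive graph_kind : Set := Directed | Undirected.

Definition edge : Set := (nat * nat)%type.

(* Simple graphs on the vertices [0, ..., n - 1]; an undirected edge is listed in one orientation only, so in
   both cases the number of edges is the length of the list. *)
Definition simple_graph (g : graph_kind) (n : nat) (E : list edge) : Prop :=
  (forall u v, In (u, v) E -> u < n /\ v < n /\ u <> v) /\
  NoDup E /\
  (g = Undirected -> forall u v, In (u, v) E -> ~ In (v, u) E).

Definition adj (g : graph_kind) (E : list edge) (u v : nat) : Prop :=
  match g with
  | Directed => In (u, v) E
  | Undirected => In (u, v) E \/ In (v, u) E
  end.

Inductive walk (g : graph_kind) (E : list edge) : nat -> nat -> nat -> Prop :=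
  | walk_nil u : walk g E 0 u u
  | walk_cons l u v x : adj g E u v -> walk g E l v x -> walk g E (S l) u x.

Definition is_distance (g : graph_kind) (E : list edge) (s t l : nat) : Prop :=
  walk g E l s t /\ forall l', walk g E l' s t -> l <= l'.

Definition min_cycle_length (g : graph_kind) : nat :=
  match g with Directed => 2 | Undirected => 3 end.

Definition has_cycle (g : graph_kind) (k : nat) (E : list edge) : Prop :=
  min_cycle_length g <= k /\
  exists x : nat -> nat,
    (forall i j, i < k -> j < k -> x i = x j -> i = j) /\
    (forall i, i < k -> adj g E (x i) (x (S i mod k))).

(* Registers 0 and 1 hold the numbers of vertices and edges, the memory holds
   the edge list from address 0 on, and everything else is 0. *)
Definition cycle_input (n m : nat) (E : list edge) : state :=
  State 0 (fun r => nth r [n; m] 0)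
    (fun a => nth a (flat_map (fun e => [fst e; snd e]) E) 0).

(* The running time is measured in [m] alone; isolated vertices are irrelevant
   and [n <= 2 * m] holds in their absence.  The program accepts by leaving a
   nonzero value in register 0. *)
Definition cycle_detectable (g : graph_kind) (k : nat) (f : nat -> R) : Prop :=
  exists (c : nat) (P : program) (C : R),
    1 <= c /\
    forall (m n : nat) (E : list edge),
      1 <= m -> n <= 2 * m -> simple_graph g n E -> length E = m ->
      exists (T : nat) (st : state),
        halts_in (word_size c m) P (cycle_input n m E) T st /\
        (INR T <= C * f m)%R /\
        (reg st 0 <> 0 <-> has_cycle g k E).

Definition k_cycle_hypothesis (g : graph_kind) : Prop :=
  forall eps : R, (0 < eps)%R ->
    exists k : nat,
      ~ cycle_detectable g k (fun m => Rpower (INR m) (2 - eps)).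

Inductive operation : Set :=
  | Insert (u v : nat)
  | Query.

Fixpoint inserted (ops : list operation) : list edge :=
  match ops with
  | [] => []
  | Insert u v :: ops => (u, v) :: inserted ops
  | Query :: ops => inserted ops
  end.

(* [n] exceeds every finite distance and encodes an infinite one. *)
Definition correct_answer (g : graph_kind) (n s t : nat) (E : list edge)
    (a : nat) : Prop :=
  is_distance g E s t a \/ ((forall l, ~ walk g E l s t) /\ a = n).

(* [correct_answers g n s t E ops outs]: [outs] lists correct answers to the
   queries in [ops], executed on the current graph [E]. *)
Inductive correct_answers (g : graph_kind) (n s t : nat) :
    list edge -> list operation -> list nat -> Prop :=
  | correct_nil E : correct_answers g n s t E [] []
  | correct_insert E u v ops outs :
      correct_answers g n s t ((u, v) :: E) ops outs ->
      correct_answers g n s t E (Insert u v :: ops) outs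
  | correct_query E a ops outs :
      correct_answer g n s t E a ->
      correct_answers g n s t E ops outs ->
      correct_answers g n s t E (Query :: ops) (a :: outs).

(* A data structure is a program for each kind of request; memory and registers
   survive from one request to the next. *)
Record data_structure : Set := DataStructure {
  preprocess : program;
  on_insert : program;
  on_query : program
}.

Definition blank : state := State 0 (fun _ => 0) (fun _ => 0).

(* Restart at the first instruction with [args] in registers 0, 1, ... *)
Definition call (st : state) (args : list nat) : state :=
  State 0 (fun r => nth r args (reg st r)) (mem st).

(* [serves w D st ops outs T]: from [st], the operations [ops] are executed
   one after the other in [T] steps altogether, and the queries return
   [outs], each read off register 0. *)
Inductive serves (w : nat) (D : data_structure) :
    state -> list operation -> list nat -> nat -> Prop :=
  | serves_nil st : serves w D st [] [] 0
  | serves_insert st u v T st' ops outs T' :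
      halts_in w (on_insert D) (call st [u; v]) T st' ->
      serves w D st' ops outs T' ->
      serves w D st (Insert u v :: ops) outs (T + T')
  | serves_query st T st' ops outs T' :
      halts_in w (on_query D) (call st []) T st' ->
      serves w D st' ops outs T' ->
      serves w D st (Query :: ops) (reg st' 0 :: outs) (T + T').

(* Preprocessing time [O(p m)] and amortized time [O(q m)] per insertion and
   per query, where [m] is the number of edges of the final graph; the graph is
   initially empty.  Letting the preprocessing see [m] only weakens the
   requirement on the data structure. *)
Definition incremental_st_path_solvable (g : graph_kind) (p q : nat -> R)
    : Prop :=
  exists (c : nat) (D : data_structure) (C : R),
    1 <= c /\
    forall (m n s t : nat), 1 <= m -> n <= 2 * m -> s < n -> t < n ->
    exists (T0 : nat) (st : state),
      halts_in (word_size c m) (preprocess D) (call blank [n; m; s; t]) T0 st /\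
      (INR T0 <= C * p m)%R /\
      forall ops : list operation,
        simple_graph g n (inserted ops) -> length (inserted ops) = m ->
        exists (outs : list nat) (T : nat),
          serves (word_size c m) D st ops outs T /\
          correct_answers g n s t [] ops outs /\
          (INR T <= C * (INR (length ops) * q m))%R.

(* Main.v *)
From Stdlib Require Import Reals Lra ZArith List Arith Lia Bool Classical Factorial.
Require Import Defs.
Import ListNotations.

Set Implicit Arguments.

(* A data structure for incremental s-t shortest paths is turned into an
   algorithm for k-cycles.

   Colour the vertices with k colours and look for a cycle that visits the
   colours 0, ..., k - 1 in order.  Split each vertex of colour 0 into an entry
   and an exit, so that such a cycle through x becomes a walk of length k from
   the entry to the exit of x.  Add a path p_0, p_1, ... leaving s = p_0 and a
   path ..., q_1, q_0 leading to t = q_0, and for x = n - 1, ..., 0 insert an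
   edge from p_x to the entry of x and one from the exit of x to q_x, then
   query.  In both the directed and the undirected case the distance after the
   insertions for x is at least 2 x + k + 2, with equality exactly if there is a
   cycle through x.

   The colourings come from residues: for a modulus q and a choice of k residues
   give colour i to the vertices with the i-th residue.  Given k distinct numbers
   below 2 m and X with X^L > m, one of (L + 1) k^2 pairwise coprime moduli of
   size O(X) separates them, since otherwise the product of the moduli would
   divide the product of the differences.  So O(X)^(k + 1) trials suffice, and
   X = O(m^(1/L)) makes this a small power of m.

   Each trial simulates the data structure, at its own word size, in a fresh
   region of the memory of a machine with a constant factor more bits. *)

(** Three features of the model shape the reduction. The machine is deterministic, so the colourings
    are enumerated; with residues a colour is computed from a vertex name in O(k) steps and no table
    is stored. The data structure learns the final number of edges during preprocessing and is
    bounded only in total over a complete sequence with that many edges, so every trial has to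
    insert equally many edges. Its programs may rely on wrap-around at their exact word size, so
    every result is reduced modulo 2^w' instead of being left in a longer word. It also expects
    blank memory, and wiping 2^w' words could exceed the time bound; polynomially many blocks fit
    into the address space, so each trial gets an untouched one.

    The vertices x are attached in descending order because the walk through x has length 2 x + k +
    2: in ascending order an early short walk would hide all later cycles.

    The hypothesis fixes k before L is chosen, so L may satisfy k + 1 <= (e / 2) L. Then there are
    O(m^(e/2)) trials of O(m^(2-e)) steps each, and half of the saving e survives. *)

Inductive steps (w : nat) (P : program) : state -> nat -> state -> Prop :=
  | steps_nil st : steps w P st 0 st
  | steps_cons st i T st' :
      nth_error P (pc st) = Some i ->
      steps w P (exec_instr w i st) T st' ->
      steps w P st (S T) st'.

Lemma steps_app w P s1 T1 s2 T2 s3 :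
  steps w P s1 T1 s2 -> steps w P s2 T2 s3 -> steps w P s1 (T1 + T2) s3.
Proof. induction 1; simpl; eauto using steps. Qed.

Lemma steps_one w P st i :
  nth_error P (pc st) = Some i -> steps w P st 1 (exec_instr w i st).
Proof. eauto using steps. Qed.

Lemma steps_halts w P s1 T s2 :
  steps w P s1 T s2 -> nth_error P (pc s2) = None -> halts_in w P s1 T s2.
Proof. induction 1; eauto using halts_in. Qed.

(** * Structured programs *)

(* Register conventions: the registers below [dreg 0] belong to the algorithm
   itself, those from [dreg 0] on hold the registers of the simulated data
   structure.  Register 4 holds [2 ^ w'] for its word size [w'], register 7 the
   base address of its memory, register 8 is scratch space. *)
Definition dreg (r : nat) : nat := 32 + r.

(* Every instruction becomes exactly two; since [2 ^ w'] divides [2 ^ w], the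
   [w']-bit result of an operation is the [w]-bit result modulo [2 ^ w']. *)
Definition sim_instr (off len : nat) (i : instr) : list instr :=
  match i with
  | Const r x => [Const (dreg r) x; Op Mod (dreg r) (dreg r) 4]
  | Op o r r1 r2 =>
      [Op o (dreg r) (dreg r1) (dreg r2); Op Mod (dreg r) (dreg r) 4]
  | Fetch r ra => [Op Add 8 (dreg ra) 7; Fetch (dreg r) 8]
  | Store ra r => [Op Add 8 (dreg ra) 7; Store 8 (dreg r)]
  | Jump l => [Jump (off + 2 * min l len); Const 8 0]
  | JumpZ r l => [JumpZ (dreg r) (off + 2 * min l len); Const 8 0]
  end.

(** There is no store command: the algorithm keeps its own data in registers, and only simulated
    programs write to memory. *)
Inductive cmd : Type :=
  | Skip
  | Cst (r x : nat)
  | Bin (o : binop) (r r1 r2 : nat)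
  | Get (r ra : nat)
  | Seq (c1 c2 : cmd)
  | If (r : nat) (c1 c2 : cmd)
  | While (r : nat) (c : cmd)
  | Sim (P : program).

Infix ";;" := Seq (at level 61, right associativity).

Fixpoint clen (c : cmd) : nat :=
  match c with
  | Skip => 0
  | Cst _ _ | Bin _ _ _ _ | Get _ _ => 1
  | Seq c1 c2 => clen c1 + clen c2
  | If _ c1 c2 => S (clen c1 + S (clen c2))
  | While _ c => S (clen c + 1)
  | Sim P => 2 * length P
  end.

Fixpoint compile (off : nat) (c : cmd) : program :=
  match c with
  | Skip => []
  | Cst r x => [Const r x]
  | Bin o r r1 r2 => [Op o r r1 r2]
  | Get r ra => [Fetch r ra]
  | Seq c1 c2 => compile off c1 ++ compile (off + clen c1) c2
  | If r c1 c2 =>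
      JumpZ r (off + S (S (clen c1))) :: compile (S off) c1 ++
      Jump (off + clen (If r c1 c2)) :: compile (off + S (S (clen c1))) c2
  | While r c =>
      JumpZ r (off + clen (While r c)) :: compile (S off) c ++ [Jump off]
  | Sim P => flat_map (sim_instr off (length P)) P
  end.

Lemma sim_instr_length off len i : length (sim_instr off len i) = 2.
Proof. destruct i; reflexivity. Qed.

Lemma flat_map_sim_length off len P :
  length (flat_map (sim_instr off len) P) = 2 * length P.
Proof.
  induction P as [|i P IH]; simpl flat_map; simpl length; [reflexivity|].
  rewrite length_app, IH, sim_instr_length; lia.
Qed.

Lemma compile_length c off : length (compile off c) = clen c.
Proof.
  revert off; induction c; intros off; cbn [compile clen length]; trivial;
    rewrite ?length_app; cbn [length]; rewrite ?length_app; cbn [length];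
    rewrite ?IHc, ?IHc1, ?IHc2; trivial; try lia.
  apply flat_map_sim_length.
Qed.

Definition code_at (P : program) (off : nat) (l : program) : Prop :=
  forall i x, nth_error l i = Some x -> nth_error P (off + i) = Some x.

Lemma code_at_app P off l1 l2 :
  code_at P off (l1 ++ l2) ->
  code_at P off l1 /\ code_at P (off + length l1) l2.
Proof.
  intros H; split; intros i x Hi.
  - apply H. rewrite nth_error_app1; trivial.
    apply nth_error_Some; congruence.
  - rewrite <- Nat.add_assoc; apply H.
    rewrite nth_error_app2 by lia. now replace (_ + i - _) with i by lia.
Qed.

Lemma code_at_cons P off x l :
  code_at P off (x :: l) ->
  nth_error P off = Some x /\ code_at P (S off) l.
Proof.
  intros H; split.
  - specialize (H 0 x eq_refl). now rewrite Nat.add_0_r in H.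
  - intros i y Hi. replace (S off + i) with (off + S i) by lia. now apply H.
Qed.

(** * Weakest preconditions with running time *)

Definition assertion : Type := (nat -> nat) -> (nat -> nat) -> nat -> Prop.

(* The third component of an assertion is a clock. *)
Definition wp (w : nat) (c : cmd) (Post : assertion) : assertion :=
  fun rg mm t =>
    forall P off, code_at P off (compile off c) ->
    exists T rg' mm',
      steps w P (State off rg mm) T (State (off + clen c) rg' mm') /\
      Post rg' mm' (t + T).

Section Rules.

Variable w : nat.

Lemma wp_skip (Q : assertion) rg mm t : Q rg mm t -> wp w Skip Q rg mm t.
Proof.
  intros H P off _. exists 0, rg, mm. simpl. rewrite !Nat.add_0_r.
  eauto using steps.
Qed.

Lemma wp_seq c1 c2 (Q : assertion) rg mm t :
  wp w c1 (wp w c2 Q) rg mm t -> wp w (c1 ;; c2) Q rg mm t.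
Proof.
  intros H P off Hc. simpl in Hc. apply code_at_app in Hc as [H1 H2].
  rewrite compile_length in H2.
  destruct (H P off H1) as (T1 & r1 & u1 & S1 & K1).
  destruct (K1 P _ H2) as (T2 & r2 & u2 & S2 & K2).
  exists (T1 + T2), r2, u2. simpl. rewrite !Nat.add_assoc.
  eauto using steps_app.
Qed.

Lemma wp_cst r x v (Q : assertion) rg mm t :
  x mod 2 ^ w = v -> Q (upd rg r v) mm (S t) -> wp w (Cst r x) Q rg mm t.
Proof.
  intros <- H P off Hc. apply code_at_cons in Hc as [Hc _].
  exists 1, (upd rg r (x mod 2 ^ w)), mm. simpl. rewrite !Nat.add_1_r.
  split; [|exact H]. now apply steps_one with (i := Const r x).
Qed.

Lemma wp_bin o r r1 r2 v (Q : assertion) rg mm t :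
  eval_binop w o (rg r1) (rg r2) = v ->
  Q (upd rg r v) mm (S t) -> wp w (Bin o r r1 r2) Q rg mm t.
Proof.
  intros <- H P off Hc. apply code_at_cons in Hc as [Hc _].
  eexists 1, _, mm. simpl. rewrite !Nat.add_1_r.
  split; [|exact H]. now apply steps_one with (i := Op o r r1 r2).
Qed.

Lemma wp_get r ra v (Q : assertion) rg mm t :
  mm (rg ra) = v ->
  Q (upd rg r v) mm (S t) -> wp w (Get r ra) Q rg mm t.
Proof.
  intros <- H P off Hc. apply code_at_cons in Hc as [Hc _].
  eexists 1, _, mm. simpl. rewrite !Nat.add_1_r.
  split; [|exact H]. now apply steps_one with (i := Fetch r ra).
Qed.

(** The additional tick in the postcondition of the first branch pays for the jump over the second
    one, which itself falls through. *)
Lemma wp_if r c1 c2 (Q : assertion) rg mm t :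
  (rg r <> 0 -> wp w c1 (fun rg mm t => Q rg mm (S t)) rg mm (S t)) ->
  (rg r = 0 -> wp w c2 Q rg mm (S t)) ->
  wp w (If r c1 c2) Q rg mm t.
Proof.
  intros H1 H2 P off Hc. cbn [compile] in Hc.
  apply code_at_cons in Hc as [Hj Hc]. apply code_at_app in Hc as [Hc1 Hc].
  rewrite compile_length in Hc. apply code_at_cons in Hc as [Hj2 Hc2].
  destruct (Nat.eq_dec (rg r) 0) as [E|E].
  - replace (S (S off + clen c1)) with (off + S (S (clen c1))) in Hc2 by lia.
    destruct (H2 E P _ Hc2) as (T & r' & u' & S1 & K1).
    exists (1 + T), r', u'. split.
    + eapply steps_app; [apply steps_one; exact Hj|].
      simpl. rewrite E. simpl.
      now replace (off + S (clen c1 + S (clen c2)))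
        with (off + S (S (clen c1)) + clen c2) by lia.
    + now replace (t + (1 + T)) with (S t + T) by lia.
  - destruct (H1 E P _ Hc1) as (T & r' & u' & S1 & K1).
    exists (1 + (T + 1)), r', u'. split.
    + eapply steps_app; [apply steps_one; exact Hj|].
      simpl. apply Nat.eqb_neq in E. rewrite E.
      eapply steps_app; [exact S1|].
      apply steps_one with (i := Jump (off + clen (If r c1 c2))). exact Hj2.
    + now replace (t + (1 + (T + 1))) with (S (S t + T)) by lia.
Qed.

(** The tested register is the variant: it holds the number of rounds left, and each round lowers it
    by exactly one. Every loop of the algorithm has this form, so termination is induction on its
    value. *)
Lemma wp_while r c (Inv : nat -> assertion) (Q : assertion) :
  (forall x rg mm t, Inv (S x) rg mm t -> rg r = S x ->
     wp w c (fun rg' mm' t' => Inv x rg' mm' (S t') /\ rg' r = x) rg mm (S t)) ->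
  (forall rg mm t, Inv 0 rg mm t -> rg r = 0 -> Q rg mm (S t)) ->
  forall x rg mm t, Inv x rg mm t -> rg r = x -> wp w (While r c) Q rg mm t.
Proof.
  intros Hs H0 x. induction x as [|x IH]; intros rg mm t HI Hr P off Hc;
    pose proof Hc as Hc'; cbn [compile] in Hc;
    apply code_at_cons in Hc as [Hj Hc]; apply code_at_app in Hc as [Hc1 Hc];
    rewrite compile_length in Hc; apply code_at_cons in Hc as [Hj2 _].
  - exists 1, rg, mm. rewrite Nat.add_1_r. split; [|auto].
    pose proof (@steps_one w P (State off rg mm) _ Hj) as S1.
    cbn [exec_instr reg pc mem] in S1. now rewrite Hr in S1.
  - destruct (Hs x rg mm t HI Hr P _ Hc1) as (T & r' & u' & S1 & K1 & K2).
    destruct (IH r' u' _ K1 K2 P off Hc') as (T2 & r2 & u2 & S2 & K3).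
    exists (1 + (T + (1 + T2))), r2, u2. split.
    + eapply steps_app; [apply steps_one; exact Hj|].
      simpl. rewrite Hr. simpl.
      eapply steps_app; [exact S1|].
      apply steps_cons with (i := Jump off); [exact Hj2|exact S2].
    + now replace (t + (1 + (T + (1 + T2)))) with (S (S t + T) + T2) by lia.
Qed.

End Rules.

(** * Arithmetic of words *)

Lemma pow2_pos w : 0 < 2 ^ w.
Proof. apply Nat.neq_0_lt_0, Nat.pow_nonzero; lia. Qed.

Lemma ev_add w a b v : a + b = v -> v < 2 ^ w -> eval_binop w Add a b = v.
Proof. intros <- H; unfold eval_binop; now apply Nat.mod_small. Qed.

Lemma ev_mul w a b v : a * b = v -> v < 2 ^ w -> eval_binop w Mul a b = v.
Proof. intros <- H; unfold eval_binop; now apply Nat.mod_small. Qed.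

Lemma ev_sub w a b v : a = b + v -> a < 2 ^ w -> eval_binop w Sub a b = v.
Proof.
  intros -> H; unfold eval_binop. replace (b + v + 2 ^ w - b) with (v + 1 * 2 ^ w) by lia.
  rewrite Nat.Div0.mod_add. apply Nat.mod_small; lia.
Qed.

Lemma ev_div w a b v : a / b = v -> a < 2 ^ w -> eval_binop w Div a b = v.
Proof.
  intros <- H; unfold eval_binop. apply Nat.mod_small.
  destruct b; [simpl; lia|].
  eapply Nat.le_lt_trans; [apply Nat.Div0.div_le_upper_bound with (q := a)|]; lia.
Qed.

Lemma ev_mod w a b v : a mod b = v -> a < 2 ^ w -> eval_binop w Mod a b = v.
Proof.
  intros <- H; unfold eval_binop. apply Nat.mod_small.
  eapply Nat.le_lt_trans; [apply Nat.Div0.mod_le|]; lia.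
Qed.

Lemma ev_lt w a b v :
  1 < 2 ^ w -> (if a <? b then 1 else 0) = v -> eval_binop w Lt a b = v.
Proof.
  intros H <-; unfold eval_binop. apply Nat.mod_small. destruct (a <? b); lia.
Qed.

Lemma ev_eq w a b v :
  1 < 2 ^ w -> (if a =? b then 1 else 0) = v -> eval_binop w Eq a b = v.
Proof.
  intros H <-; unfold eval_binop. apply Nat.mod_small. destruct (a =? b); lia.
Qed.

Lemma lor_bits_small w a b : a < 2 ^ w -> b < 2 ^ w -> Nat.lor a b < 2 ^ w.
Proof.
  intros Ha Hb. destruct (Nat.eq_dec (Nat.lor a b) 0) as [E|E].
  - rewrite E. apply pow2_pos.
  - apply Nat.log2_lt_pow2; [lia|]. rewrite Nat.log2_lor.
    assert (w <> 0).
    { intros ->. simpl in *. replace a with 0 in E by lia.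
      replace b with 0 in E by lia. now apply E. }
    apply Nat.max_lub_lt.
    + destruct (Nat.eq_dec a 0) as [->|]; [rewrite Nat.log2_nonpos; lia|].
      apply Nat.log2_lt_pow2; lia.
    + destruct (Nat.eq_dec b 0) as [->|]; [rewrite Nat.log2_nonpos; lia|].
      apply Nat.log2_lt_pow2; lia.
Qed.

Lemma ev_or w a b v :
  Nat.lor a b = v -> a < 2 ^ w -> b < 2 ^ w -> eval_binop w Or a b = v.
Proof.
  intros <- Ha Hb; unfold eval_binop. apply Nat.mod_small. now apply lor_bits_small.
Qed.

(** The instruction set has no copy between registers; [Or] of a register with itself takes its
    place. *)
Lemma ev_move w a : a < 2 ^ w -> eval_binop w Or a a = a.
Proof. intros H. apply ev_or; trivial. apply Nat.lor_diag. Qed.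

Lemma mod_pow2_mod_pow2 v w x :
  v <= w -> (x mod 2 ^ w) mod 2 ^ v = x mod 2 ^ v.
Proof.
  intros H. replace w with (v + (w - v)) by lia.
  rewrite Nat.pow_add_r, Nat.Div0.mod_mul_r.
  rewrite (Nat.mul_comm (2 ^ v)), Nat.Div0.mod_add. apply Nat.Div0.mod_mod.
Qed.

(** Before the final reduction only [Sub] mentions the word size. Its two values differ by a
    multiple of 2^v, and [b <= 2 ^ v] keeps the subtraction on natural numbers from being cut off at
    0. *)
Lemma eval_binop_narrow v w o a b :
  v <= w -> b <= 2 ^ v ->
  eval_binop w o a b mod 2 ^ v = eval_binop v o a b.
Proof.
  intros H Hb. unfold eval_binop. rewrite mod_pow2_mod_pow2 by trivial.
  destruct o; trivial.
  replace w with (v + (w - v)) by lia. rewrite Nat.pow_add_r.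
  destruct (2 ^ (w - v)) as [|y] eqn:E;
    [pose proof (pow2_pos (w - v)); lia|].
  replace (a + 2 ^ v * S y - b) with (a + 2 ^ v - b + y * 2 ^ v) by nia.
  apply Nat.Div0.mod_add.
Qed.

(** * Simulating a program with a smaller word size *)

Definition regs_below (B : nat) (i : instr) : Prop :=
  match i with
  | Const r _ | JumpZ r _ => r < B
  | Op _ r r1 r2 => r < B /\ r1 < B /\ r2 < B
  | Fetch r r' | Store r r' => r < B /\ r' < B
  | Jump _ => True
  end.

(** The claim holds for all larger bounds too, so one bound serves the three programs of a data
    structure, and resetting its registers takes constant time. *)
Lemma regs_below_exists (P : program) :
  exists B, forall B', B <= B' -> Forall (regs_below B') P.
Proof.
  induction P as [|i P [B IH]]; [exists 0; auto|].
  assert (exists B1, forall B', B1 <= B' -> regs_below B' i) as [B1 H1].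
  { destruct i as [r x|o r r1 r2|r ra|ra r|l|r l];
      [exists (S r)|exists (S (r + r1 + r2))|exists (S (r + ra))
      |exists (S (r + ra))|exists 0|exists (S r)];
      intros B' HB; simpl; lia. }
  exists (B1 + B). intros B' HB. constructor; [apply H1|apply IH]; lia.
Qed.

Section Simulation.

Variables (w v B base : nat).
Hypothesis Hvw : v <= w.
Hypothesis Hbase : base + 2 ^ v < 2 ^ w.

(** Contents are recorded to be below 2^v because any register may be used as an address, which must
    stay inside the block at [base]. *)
Definition simulates (st : state) (rg mm : nat -> nat) : Prop :=
  rg 4 = 2 ^ v /\ rg 7 = base /\
  (forall r, r < B -> rg (dreg r) = reg st r /\ reg st r < 2 ^ v) /\
  (forall a, a < 2 ^ v -> mm (base + a) = mem st a /\ mem st a < 2 ^ v).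

(** Nothing is promised above [base]: the trials use blocks of decreasing address, so only what lies
    below the current block is read again. *)
Definition framed (rg mm rg' mm' : nat -> nat) : Prop :=
  (forall r, r < 32 -> r <> 8 -> rg' r = rg r) /\
  (forall a, a < base -> mm' a = mm a).

Lemma framed_trans rg1 mm1 rg2 mm2 rg3 mm3 :
  framed rg1 mm1 rg2 mm2 -> framed rg2 mm2 rg3 mm3 -> framed rg1 mm1 rg3 mm3.
Proof.
  intros [H1 H2] [H3 H4]; split; intros.
  - rewrite H3; auto.
  - rewrite H4; auto.
Qed.

Lemma upd_same f a x : upd f a x a = x.
Proof. unfold upd. now rewrite Nat.eqb_refl. Qed.

Lemma upd_other f a x b : b <> a -> upd f a x b = f b.
Proof. intros H. unfold upd. apply Nat.eqb_neq in H. now rewrite H. Qed.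

Lemma simulates_set_reg st rg mm rg' r x pc' :
  simulates st rg mm -> x < 2 ^ v ->
  rg' (dreg r) = x ->
  (forall s, s <> 8 -> s <> dreg r -> rg' s = rg s) ->
  simulates (State pc' (upd (reg st) r x) (mem st)) rg' mm /\
  framed rg mm rg' mm.
Proof.
  intros (H4 & H7 & HR & HM) Hx Hr Ho. unfold dreg in *.
  split; [|split; intros; trivial; apply Ho; lia].
  split; [rewrite Ho by lia; exact H4|].
  split; [rewrite Ho by lia; exact H7|].
  split; [|exact HM].
  intros s Hs. simpl reg. unfold upd. destruct (Nat.eqb_spec s r) as [->|N].
  - auto.
  - rewrite Ho by (unfold dreg; lia). now apply HR.
Qed.

Lemma simulates_scratch st rg mm rg' pc' :
  simulates st rg mm ->
  (forall s, s <> 8 -> rg' s = rg s) ->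
  simulates (State pc' (reg st) (mem st)) rg' mm /\
  framed rg mm rg' mm.
Proof.
  intros (H4 & H7 & HR & HM) Ho. unfold dreg in *.
  split; [|split; intros; trivial; apply Ho; lia].
  split; [rewrite Ho by lia; exact H4|].
  split; [rewrite Ho by lia; exact H7|].
  split; [|exact HM].
  intros s Hs. unfold dreg. rewrite Ho by lia. now apply HR.
Qed.

Lemma nth_error_flat_map_sim off len P i x :
  nth_error P i = Some x ->
  nth_error (flat_map (sim_instr off len) P) (2 * i) =
    nth_error (sim_instr off len x) 0 /\
  nth_error (flat_map (sim_instr off len) P) (S (2 * i)) =
    nth_error (sim_instr off len x) 1.
Proof.
  revert i; induction P as [|y P IH]; intros [|i] H; simpl in H;
    try discriminate; cbn [flat_map].
  - injection H as ->. now destruct x.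
  - replace (2 * S i) with (2 + 2 * i) by lia.
    rewrite !nth_error_app2 by (rewrite sim_instr_length; lia).
    rewrite sim_instr_length.
    replace (2 + 2 * i - 2) with (2 * i) by lia.
    replace (S (2 + 2 * i) - 2) with (S (2 * i)) by lia. now apply IH.
Qed.

Lemma sim_exec P Pr off st i rg mm :
  Forall (regs_below B) P ->
  code_at Pr off (compile off (Sim P)) ->
  nth_error P (pc st) = Some i ->
  simulates st rg mm ->
  exists T rg' mm',
    T <= 2 /\
    steps w Pr (State (off + 2 * min (pc st) (length P)) rg mm) T
      (State (off + 2 * min (pc (exec_instr v i st)) (length P)) rg' mm') /\
    simulates (exec_instr v i st) rg' mm' /\ framed rg mm rg' mm'.
Proof.
  intros HB Hc Hi Hs.
  assert (Hlt : pc st < length P) by (apply nth_error_Some; congruence).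
  pose proof (proj1 (Forall_forall _ _) HB i (nth_error_In _ _ Hi)) as Hb.
  destruct (nth_error_flat_map_sim off (length P) _ _ Hi) as [N1 N2].
  assert (C1 : forall x, nth_error (sim_instr off (length P) i) 0 = Some x ->
            nth_error Pr (off + 2 * pc st) = Some x)
    by (intros x Hx; apply Hc; simpl compile; congruence).
  assert (C2 : forall x, nth_error (sim_instr off (length P) i) 1 = Some x ->
            nth_error Pr (S (off + 2 * pc st)) = Some x).
  { intros x Hx. replace (S (off + 2 * pc st)) with (off + S (2 * pc st)) by lia.
    apply Hc; simpl compile; congruence. }
  clear N1 N2 Hc. rewrite (Nat.min_l (pc st)) by lia.
  pose proof Hs as (H4 & H7 & HR & HM).
  pose proof (pow2_pos v) as Hv.
  assert (Hw : 2 ^ v < 2 ^ w) by lia.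
  assert (Hsmall : forall y, (y mod 2 ^ v) mod 2 ^ w = y mod 2 ^ v).
  { intros y. apply Nat.mod_small.
    pose proof (Nat.mod_upper_bound y (2 ^ v)); lia. }
  destruct i as [r x|o r r1 r2|r ra|ra r|l|r l]; cbn [regs_below] in Hb.
  - exists 2. eexists _, mm. split; [lia|]. split.
    + rewrite Nat.min_l by (simpl; lia).
      replace (off + 2 * pc (exec_instr v (Const r x) st))
        with (S (S (off + 2 * pc st))) by (simpl; lia).
      eapply steps_cons; [now apply C1|].
      eapply steps_cons; [now apply C2|apply steps_nil].
    + apply simulates_set_reg; trivial.
      * apply Nat.mod_upper_bound; lia.
      * cbn [exec_instr reg pc mem].
        rewrite !upd_same, upd_other by (unfold dreg; lia).
        unfold eval_binop. now rewrite H4, Hsmall, mod_pow2_mod_pow2.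
      * intros s Hs1 Hs2. cbn [exec_instr reg pc mem]. now rewrite !upd_other.
  - destruct Hb as (B0 & B1 & B2).
    exists 2. eexists _, mm. split; [lia|]. split.
    + rewrite Nat.min_l by (simpl; lia).
      replace (off + 2 * pc (exec_instr v (Op o r r1 r2) st))
        with (S (S (off + 2 * pc st))) by (simpl; lia).
      eapply steps_cons; [now apply C1|].
      eapply steps_cons; [now apply C2|apply steps_nil].
    + apply simulates_set_reg; trivial.
      * apply Nat.mod_upper_bound; lia.
      * cbn [exec_instr reg pc].
        rewrite !upd_same, upd_other by (unfold dreg; lia).
        destruct (HR _ B1) as [-> _], (HR _ B2) as [-> L2].
        rewrite H4. unfold eval_binop at 1. rewrite Hsmall.
        apply eval_binop_narrow; lia.
      * intros s Hs1 Hs2. cbn [exec_instr reg pc mem]. now rewrite !upd_other.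
  - destruct Hb as (B0 & B1). destruct (HR _ B1) as [E1 L1].
    destruct (HM _ L1) as [E2 L2].
    exists 2. eexists _, mm. split; [lia|]. split.
    + rewrite Nat.min_l by (simpl; lia).
      replace (off + 2 * pc (exec_instr v (Fetch r ra) st))
        with (S (S (off + 2 * pc st))) by (simpl; lia).
      eapply steps_cons; [now apply C1|].
      eapply steps_cons; [now apply C2|apply steps_nil].
    + apply simulates_set_reg; trivial.
      * cbn [exec_instr reg pc mem]. rewrite !upd_same, E1, H7.
        rewrite ev_add with (v := base + reg st ra) by lia. exact E2.
      * intros s Hs1 Hs2. cbn [exec_instr reg pc mem]. now rewrite !upd_other.
  - destruct Hb as (B0 & B1). destruct (HR _ B0) as [E1 L1].
    destruct (HR _ B1) as [E2 L2].
    exists 2. eexists _, _. split; [lia|]. split.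
    + rewrite Nat.min_l by (simpl; lia).
      replace (off + 2 * pc (exec_instr v (Store ra r) st))
        with (S (S (off + 2 * pc st))) by (simpl; lia).
      eapply steps_cons; [now apply C1|].
      eapply steps_cons; [now apply C2|apply steps_nil].
    + cbn [exec_instr reg pc mem]. rewrite upd_same, E1, H7.
      rewrite ev_add with (v := base + reg st ra) by lia.
      rewrite upd_other by (unfold dreg; lia). rewrite E2. repeat split.
      * exact H4.
      * exact H7.
      * rewrite upd_other by (unfold dreg; lia). now apply HR.
      * now apply HR.
      * unfold upd. simpl mem.
        destruct (Nat.eqb_spec (base + a) (base + reg st ra)),
          (Nat.eqb_spec a (reg st ra)); try lia; trivial. now apply HM.
      * unfold upd. simpl mem.
        destruct (Nat.eqb_spec a (reg st ra)); trivial. now apply HM.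
      * intros s Hs1 Hs2. now rewrite upd_other.
      * intros a Ha. now rewrite upd_other by lia.
  - exists 1. eexists _, mm. split; [lia|]. split.
    + eapply steps_one with (i := Jump (off + 2 * min l (length P))).
      now apply C1.
    + cbn. now apply simulates_scratch.
  - destruct (HR _ Hb) as [E1 L1].
    destruct (Nat.eqb_spec (reg st r) 0) as [E|E].
    + exists 1, rg, mm. split; [lia|]. split.
      * cbn [exec_instr reg pc mem]. rewrite E. cbn [Nat.eqb].
        replace (State (off + 2 * min l (length P)) rg mm) with
          (exec_instr w (JumpZ (dreg r) (off + 2 * min l (length P)))
             (State (off + 2 * pc st) rg mm))
          by (cbn [exec_instr reg pc mem]; now rewrite E1, E).
        apply steps_one. now apply C1.
      * now apply simulates_scratch.
    + exists 2. eexists _, mm. split; [lia|]. split.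
      * cbn [exec_instr pc]. apply Nat.eqb_neq in E. rewrite E.
        rewrite Nat.min_l by (simpl; lia).
        eapply steps_cons; [now apply C1|].
        eapply steps_cons; [cbn [exec_instr reg pc mem]; rewrite E1, E; now apply C2|].
        cbn [exec_instr reg pc mem]. rewrite E1, E.
        replace (off + 2 * S (pc st)) with (S (S (off + 2 * pc st))) by lia.
        apply steps_nil.
      * apply simulates_scratch; trivial.
        intros s Hs1. now rewrite upd_other.
Qed.

(** Jump targets are clamped to the length of [P], so every way of leaving the simulated program
    ends at the instruction after its translation. *)
Lemma sim_halts P Pr off st T st' :
  Forall (regs_below B) P ->
  code_at Pr off (compile off (Sim P)) ->
  halts_in v P st T st' ->
  forall rg mm, simulates st rg mm ->
  exists T' rg' mm',
    T' <= 2 * T /\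
    steps w Pr (State (off + 2 * min (pc st) (length P)) rg mm) T'
      (State (off + 2 * length P) rg' mm') /\
    simulates st' rg' mm' /\ framed rg mm rg' mm'.
Proof.
  intros HB Hc. induction 1 as [st Hn|st i T st' Hi _ IH]; intros rg mm Hs.
  - exists 0, rg, mm. apply nth_error_None in Hn.
    rewrite Nat.min_r by trivial. repeat split; trivial; try apply Hs; auto.
    constructor.
  - destruct (sim_exec HB Hc Hi Hs) as (T1 & r1 & u1 & L1 & S1 & M1 & F1).
    destruct (IH _ _ M1) as (T2 & r2 & u2 & L2 & S2 & M2 & F2).
    exists (T1 + T2), r2, u2. repeat split; trivial; try apply M2; try lia.
    + eauto using steps_app.
    + apply (framed_trans F1 F2).
    + apply (framed_trans F1 F2).
Qed.

Lemma wp_sim P st T st' (Q : assertion) rg mm t :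
  Forall (regs_below B) P ->
  halts_in v P st T st' -> pc st = 0 -> simulates st rg mm ->
  (forall rg' mm' t', t' <= t + 2 * T ->
     simulates st' rg' mm' -> framed rg mm rg' mm' -> Q rg' mm' t') ->
  wp w (Sim P) Q rg mm t.
Proof.
  intros HB HT H0 Hs HQ Pr off Hc.
  destruct (sim_halts HB Hc HT Hs) as (T1 & r1 & u1 & L1 & S1 & M1 & F1).
  rewrite H0 in S1. simpl min in S1. rewrite Nat.mul_0_r, Nat.add_0_r in S1.
  exists T1, r1, u1. split; [exact S1|]. apply HQ; trivial. lia.
Qed.

End Simulation.

(** * The layered graph *)

Definition is_undirected (h : graph_kind) : bool :=
  match h with Directed => false | Undirected => true end.

Lemma inserted_app ops1 ops2 :
  inserted (ops1 ++ ops2) = inserted ops1 ++ inserted ops2.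
Proof.
  induction ops1 as [|[u v|] ops1 IH]; simpl; trivial. now rewrite IH.
Qed.

Section Layered.

Variables (h g : graph_kind) (n k : nat) (E : list edge) (col : nat -> nat).

(* Vertex names: [v] and [n + v] are the entry and the exit of a vertex [v] of
   colour 0, [2 * n + v] stands for a vertex of another colour, [3 * n + x] and
   [4 * n + 1 + x] (with [x <= n]) form the path leaving [s] and the path
   leading to [t], and from [5 * n + 2] on there is a star of useless edges that
   makes the number of insertions independent of the colouring. *)

Definition source (u : nat) : nat := if col u =? 0 then u else 2 * n + u.
Definition target (v : nat) : nat := if col v =? 0 then n + v else 2 * n + v.

Definition consecutive (a b : nat) : bool := (a <? k) && (S a mod k =? b).

(** The flag [b] says whether this orientation of the input edge exists at all. An unusable arc
    becomes a star edge with its own leaf [i], so an input edge always yields two insertions and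
    none is repeated. *)
Definition arc_edge (b : bool) (i u v : nat) : edge :=
  if b && consecutive (col u) (col v) then (source u, target v)
  else (5 * n + 2, 5 * n + 3 + i).

Fixpoint path_ops (x : nat) : list operation :=
  match x with
  | 0 => []
  | S x => Insert (3 * n + x) (3 * n + S x)
             :: Insert (4 * n + 1 + S x) (4 * n + 1 + x) :: path_ops x
  end.

Definition ins (e : edge) : operation := Insert (fst e) (snd e).

Fixpoint arc_ops (e : nat) : list operation :=
  match e with
  | 0 => []
  | S e =>
      let (u, v) := nth e E (0, 0) in
      ins (arc_edge true (2 * e) u v)
        :: ins (arc_edge (is_undirected h) (2 * e + 1) v u) :: arc_ops e
  end.

Fixpoint phase_ops (x : nat) : list operation :=
  match x with
  | 0 => []
  | S x => Insert (3 * n + x) x :: Insert (n + x) (4 * n + 1 + x) :: Query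
             :: phase_ops x
  end.

Definition layered_ops : list operation :=
  path_ops n ++ arc_ops (length E) ++ phase_ops n.

Definition order : nat := 5 * n + 3 + 2 * length E.

(** This describes the graph independently of the order of insertion. It lists all star edges,
    inserted or not, since the star is disconnected from everything else. *)
Inductive layered_edge (X : nat) : nat -> nat -> Prop :=
  | le_p x : x < n -> layered_edge X (3 * n + x) (3 * n + S x)
  | le_q x : x < n -> layered_edge X (4 * n + 1 + S x) (4 * n + 1 + x)
  | le_arc u v : adj h E u v -> col u < k -> col v = S (col u) mod k ->
      layered_edge X (source u) (target v)
  | le_star i : i < 2 * length E -> layered_edge X (5 * n + 2) (5 * n + 3 + i)
  | le_in x : X <= x < n -> layered_edge X (3 * n + x) x
  | le_out x : X <= x < n -> layered_edge X (n + x) (4 * n + 1 + x).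

(* At the stage where the edges of the vertices [x >= X] are in place, an edge
   never raises the potential by more than one, and a shortest possible
   [s]-[t] walk raises it by one in each step. *)
Definition potential (X a : nat) : nat :=
  if a <? n then S X
  else if a <? 2 * n then S X + k
  else if a <? 3 * n then S X + col (a - 2 * n)
  else if a <=? 4 * n then min (a - 3 * n) (S X)
  else if a <=? 5 * n + 1 then S X + k + (S X - (a - (4 * n + 1)))
  else if a =? 5 * n + 2 then 0
  else 1.

Ltac cases_potential :=
  unfold potential, source, target in *;
  repeat match goal with
  | |- context [?a <? ?b] => destruct (Nat.ltb_spec a b); try lia
  | |- context [?a <=? ?b] => destruct (Nat.leb_spec a b); try lia
  | |- context [?a =? ?b] => destruct (Nat.eqb_spec a b); try lia
  end.

Lemma source_bound u : u < n -> source u < n \/ 2 * n <= source u < 3 * n.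
Proof. intros. cases_potential. Qed.

Lemma target_bound u : u < n -> n <= target u < 3 * n.
Proof. intros. cases_potential. Qed.

Lemma source_inj u v : u < n -> v < n -> source u = source v -> u = v.
Proof.
  unfold source. destruct (col u =? 0), (col v =? 0); lia.
Qed.

Lemma target_inj u v : u < n -> v < n -> target u = target v -> u = v.
Proof.
  unfold target. destruct (col u =? 0), (col v =? 0); lia.
Qed.

Lemma path_ops_length x : length (inserted (path_ops x)) = 2 * x.
Proof. induction x; cbn [path_ops inserted length]; lia. Qed.

Lemma arc_ops_length x : length (inserted (arc_ops x)) = 2 * x.
Proof.
  induction x; cbn [arc_ops]; trivial.
  destruct (nth x E (0, 0)). cbn [inserted ins length]. lia.
Qed.

Lemma phase_ops_length x : length (inserted (phase_ops x)) = 2 * x.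
Proof. induction x; cbn [phase_ops inserted length]; lia. Qed.

(** The value does not depend on [col]; hence one run of the preprocessing, with one final number of
    edges, fits all colourings. *)
Lemma layered_ops_size :
  length (inserted layered_ops) = 2 * length E + 4 * n.
Proof.
  unfold layered_ops. rewrite !inserted_app, !length_app.
  rewrite path_ops_length, arc_ops_length, phase_ops_length. lia.
Qed.

Lemma path_ops_all_length x : length (path_ops x) = 2 * x.
Proof. induction x; cbn [path_ops length]; lia. Qed.

Lemma arc_ops_all_length x : length (arc_ops x) = 2 * x.
Proof.
  induction x; cbn [arc_ops]; trivial.
  destruct (nth x E (0, 0)). cbn [length]. lia.
Qed.

Lemma phase_ops_all_length x : length (phase_ops x) = 3 * x.
Proof. induction x; cbn [phase_ops length]; lia. Qed.

Lemma layered_ops_length : length layered_ops = 2 * length E + 5 * n.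
Proof.
  unfold layered_ops. rewrite !length_app.
  rewrite path_ops_all_length, arc_ops_all_length, phase_ops_all_length. lia.
Qed.

Hypothesis HE : simple_graph h n E.

Lemma adj_bounds u v : adj h E u v -> u < n /\ v < n.
Proof.
  destruct HE as [H _]. destruct h; simpl.
  - intros Hin. apply H in Hin. lia.
  - intros [Hin|Hin]; apply H in Hin; lia.
Qed.

Hypothesis Hk : 2 <= k.

Lemma next_colour a : a < k ->
  (S a = k /\ S a mod k = 0) \/ (S a < k /\ S a mod k = S a).
Proof.
  intros H. destruct (Nat.eq_dec (S a) k) as [e|e].
  - left. rewrite e. split; trivial. apply Nat.Div0.mod_same.
  - right. split; [lia|]. apply Nat.mod_small; lia.
Qed.

Lemma potential_p X x : x <= n -> potential X (3 * n + x) = min x (S X).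
Proof. intros H. cases_potential. Qed.

Lemma potential_q X x :
  x <= n -> potential X (4 * n + 1 + x) = S X + k + (S X - x).
Proof. intros H. cases_potential. Qed.

Lemma potential_entry X x : x < n -> potential X x = S X.
Proof. intros H. cases_potential. Qed.

Lemma potential_exit X x : x < n -> potential X (n + x) = S X + k.
Proof. intros H. cases_potential. Qed.

Lemma potential_mid X x : x < n -> potential X (2 * n + x) = S X + col x.
Proof.
  intros H. cases_potential. now replace (2 * n + x - 2 * n) with x by lia.
Qed.

Lemma potential_source X u : u < n -> potential X (source u) = S X + col u.
Proof.
  intros H. unfold source. destruct (Nat.eqb_spec (col u) 0).
  - rewrite potential_entry; lia.
  - now apply potential_mid.
Qed.

Lemma potential_target X u v : u < n -> v < n -> col u < k ->
  col v = S (col u) mod k -> potential X (target v) = S X + S (col u).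
Proof.
  intros Hu Hv Hc Hn. unfold target.
  destruct (next_colour Hc) as [[H1 H2]|[H1 H2]]; rewrite Hn, H2.
  - simpl. rewrite potential_exit; lia.
  - simpl. rewrite potential_mid; lia.
Qed.

Lemma potential_star X i : potential X (5 * n + 3 + i) = 1.
Proof. cases_potential. Qed.

Lemma potential_centre X : potential X (5 * n + 2) = 0.
Proof. cases_potential. Qed.

(** The potential never falls along an edge, so traversing one backwards gains nothing. This is what
    lets one argument cover directed and undirected data structures. *)
Lemma potential_edge X a b : layered_edge X a b ->
  potential X b = potential X a \/ potential X b = S (potential X a).
Proof.
  destruct 1 as [x Hx|x Hx|u v Ha Hc Hn|i Hi|x Hx|x Hx].
  - rewrite !potential_p by lia. lia.
  - rewrite !potential_q by lia. lia.
  - destruct (adj_bounds _ _ Ha). rewrite potential_source by trivial.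
    rewrite (potential_target _ (u := u)) by trivial. lia.
  - rewrite potential_star, potential_centre. lia.
  - rewrite potential_p, potential_entry by lia. lia.
  - rewrite potential_q, potential_exit by lia. lia.
Qed.

(** At stage [n] the caps in the potential are inactive, so it grows strictly along every edge of
    the final graph. This excludes loops and pairs of opposite edges, as simplicity requires. *)
Lemma potential_strict a b :
  layered_edge 0 a b -> potential n a < potential n b.
Proof.
  destruct 1 as [x Hx|x Hx|u v Ha Hc Hn|i Hi|x Hx|x Hx].
  - rewrite !potential_p by lia. lia.
  - rewrite !potential_q by lia. lia.
  - destruct (adj_bounds _ _ Ha). rewrite potential_source by trivial.
    rewrite (potential_target _ (u := u)) by trivial. lia.
  - rewrite potential_star, potential_centre. lia.
  - rewrite potential_p, potential_entry by lia. lia.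
  - rewrite potential_q, potential_exit by lia. lia.
Qed.

Lemma layered_edge_bounds a b : layered_edge 0 a b -> a < order /\ b < order.
Proof.
  unfold order.
  destruct 1 as [x Hx|x Hx|u v Ha Hc Hn|i Hi|x Hx|x Hx]; try lia.
  destruct (adj_bounds _ _ Ha) as [Hu Hv].
  pose proof (source_bound Hu). pose proof (target_bound Hv). lia.
Qed.

Lemma in_path_ops x a b : In (a, b) (inserted (path_ops x)) ->
  exists y, y < x /\ (a = 3 * n + y /\ b = 3 * n + S y \/
                      a = 4 * n + 1 + S y /\ b = 4 * n + 1 + y).
Proof.
  induction x as [|x IH]; cbn [path_ops inserted In]; [tauto|].
  intros [H|[H|H]].
  - injection H as <- <-. exists x. lia.
  - injection H as <- <-. exists x. lia.
  - destruct (IH H) as (y & H1 & H2). exists y. lia.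
Qed.

Lemma path_ops_in x y : y < x ->
  In (3 * n + y, 3 * n + S y) (inserted (path_ops x)) /\
  In (4 * n + 1 + S y, 4 * n + 1 + y) (inserted (path_ops x)).
Proof.
  induction x as [|x IH]; intros H; [lia|]. cbn [path_ops inserted In].
  destruct (Nat.eq_dec y x) as [->|]; [tauto|].
  destruct IH; [lia|tauto].
Qed.

Lemma in_arc_ops e a b : In (a, b) (inserted (arc_ops e)) ->
  exists e' u v, e' < e /\ nth e' E (0, 0) = (u, v) /\
    ((a, b) = arc_edge true (2 * e') u v \/
     (a, b) = arc_edge (is_undirected h) (2 * e' + 1) v u).
Proof.
  induction e as [|e IH]; cbn [arc_ops]; [simpl; tauto|].
  destruct (nth e E (0, 0)) as [u v] eqn:En.
  cbn [inserted ins In]. rewrite <- !surjective_pairing.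
  intros [H|[H|H]].
  - exists e, u, v. auto.
  - exists e, u, v. auto.
  - destruct (IH H) as (e' & u' & v' & H1 & H2). exists e', u', v'. auto.
Qed.

Lemma arc_ops_in e e' u v : e' < e -> nth e' E (0, 0) = (u, v) ->
  In (arc_edge true (2 * e') u v) (inserted (arc_ops e)) /\
  In (arc_edge (is_undirected h) (2 * e' + 1) v u) (inserted (arc_ops e)).
Proof.
  induction e as [|e IH]; intros H Hn; [lia|]. cbn [arc_ops].
  destruct (nth e E (0, 0)) as [u' v'] eqn:En.
  cbn [inserted ins In]. rewrite <- !surjective_pairing.
  destruct (Nat.eq_dec e' e) as [->|].
  - rewrite Hn in En. injection En as <- <-. auto.
  - destruct IH; [lia|trivial|auto].
Qed.

Lemma in_phase_ops x a b : In (a, b) (inserted (phase_ops x)) ->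
  exists y, y < x /\ (a = 3 * n + y /\ b = y \/
                      a = n + y /\ b = 4 * n + 1 + y).
Proof.
  induction x as [|x IH]; cbn [phase_ops inserted In]; [tauto|].
  intros [H|[H|H]].
  - injection H as <- <-. exists x. lia.
  - injection H as <- <-. exists x. lia.
  - destruct (IH H) as (y & H1 & H2). exists y. lia.
Qed.

Lemma consecutive_spec a b :
  consecutive a b = true <-> a < k /\ b = S a mod k.
Proof.
  unfold consecutive. rewrite andb_true_iff, Nat.ltb_lt, Nat.eqb_eq.
  intuition congruence.
Qed.

Lemma arc_edge_layered X b i u v :
  (b = true -> adj h E u v) -> i < 2 * length E ->
  layered_edge X (fst (arc_edge b i u v)) (snd (arc_edge b i u v)).
Proof.
  intros Hb Hi. unfold arc_edge.
  destruct (b && consecutive (col u) (col v)) eqn:Ec; simpl fst; simpl snd.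
  - apply andb_true_iff in Ec as [H1 H2]. apply consecutive_spec in H2 as [].
    apply le_arc; auto.
  - now apply le_star.
Qed.

Lemma nth_adj e u v : e < length E -> nth e E (0, 0) = (u, v) ->
  adj h E u v /\ (is_undirected h = true -> adj h E v u).
Proof.
  intros He Hn. assert (Hin : In (u, v) E) by (rewrite <- Hn; now apply nth_In).
  destruct h; simpl; split; auto. discriminate.
Qed.

(** * The graph between the queries *)

(** Edges at the star centre are exempt from the second condition because the colouring decides
    which of them are inserted. *)
Definition stage (X : nat) (F : list edge) : Prop :=
  (forall a b, In (a, b) F -> layered_edge X a b) /\
  (forall a b, layered_edge X a b -> a <> 5 * n + 2 -> In (a, b) F).

Lemma stage_initial F :
  (forall e, In e F <->
     In e (inserted (path_ops n ++ arc_ops (length E)))) -> stage n F.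
Proof.
  intros HF. split; intros a b.
  - intros H. apply HF in H. rewrite inserted_app in H.
    apply in_app_or in H as [H|H].
    + apply in_path_ops in H as (y & Hy & [[-> ->]|[-> ->]]);
        now constructor.
    + apply in_arc_ops in H as (e & u & v & He & Hn & [H|H]);
        destruct (nth_adj He Hn) as [A1 A2];
        change a with (fst (a, b)); change b with (snd (a, b)) at 2;
        rewrite H; apply arc_edge_layered; auto; lia.
  - intros H Hs. apply HF. rewrite inserted_app. apply in_or_app.
    destruct H as [x Hx|x Hx|u v Ha Hc Hn|i Hi|x Hx|x Hx]; try lia.
    + left. now apply path_ops_in.
    + left. now apply path_ops_in.
    + right. assert (Hcon : consecutive (col u) (col v) = true)
        by now apply consecutive_spec.
      assert (Hcases : In (u, v) E \/ is_undirected h = true /\ In (v, u) E)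
        by (destruct h; simpl in *; tauto).
      destruct Hcases as [Hin|[Hu Hin]];
        apply (In_nth _ _ (0, 0)) in Hin as (e & He & Hne);
        destruct (arc_ops_in He Hne) as [I1 I2];
        unfold arc_edge in *; rewrite ?Hu, ?Hcon in *; trivial.
Qed.

Lemma stage_next X F : X < n -> stage (S X) F ->
  stage X ((n + X, 4 * n + 1 + X) :: (3 * n + X, X) :: F).
Proof.
  intros HX [H1 H2]. split; intros a b.
  - intros [H|[H|H]].
    + injection H as <- <-. apply le_out; lia.
    + injection H as <- <-. apply le_in; lia.
    + destruct (H1 _ _ H); constructor; trivial; lia.
  - intros [x Hx|x Hx|u v Ha Hc Hn|i Hi|x Hx|x Hx] Hs; try lia; simpl;
      try (right; right; apply H2; trivial; constructor; trivial; lia).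
    + destruct (Nat.eq_dec x X) as [->|]; [tauto|].
      right; right; apply H2; trivial; constructor; lia.
    + destruct (Nat.eq_dec x X) as [->|]; [tauto|].
      right; right; apply H2; trivial; constructor; lia.
Qed.

Lemma layered_ops_edges a b :
  In (a, b) (inserted layered_ops) -> layered_edge 0 a b.
Proof.
  unfold layered_ops. rewrite !inserted_app. rewrite !in_app_iff.
  intros [H|[H|H]].
  - apply in_path_ops in H as (y & Hy & [[-> ->]|[-> ->]]);
      now constructor.
  - apply in_arc_ops in H as (e & u & v & He & Hn & [H|H]);
      destruct (nth_adj He Hn) as [A1 A2];
      change a with (fst (a, b)); change b with (snd (a, b)) at 2;
      rewrite H; apply arc_edge_layered; auto; lia.
  - apply in_phase_ops in H as (y & Hy & [[-> ->]|[-> ->]]);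
      constructor; lia.
Qed.

Lemma arc_edge_inj b i u v b' i' u' v' :
  u < n -> v < n -> u' < n -> v' < n ->
  arc_edge b i u v = arc_edge b' i' u' v' ->
  i = i' \/ (u = u' /\ v = v' /\ b = true /\ b' = true).
Proof.
  intros Hu Hv Hu' Hv'. unfold arc_edge.
  pose proof (source_bound Hu). pose proof (source_bound Hu').
  destruct b, b', (consecutive (col u) (col v)), (consecutive (col u') (col v'));
    simpl; intros H'; injection H'; intros; try lia.
  right. auto using source_inj, target_inj.
Qed.

Lemma path_ops_NoDup x : x <= n -> NoDup (inserted (path_ops x)).
Proof.
  induction x as [|x IH]; intros Hx; cbn [path_ops inserted]; constructor.
  - intros [H|H]; [injection H; lia|].
    apply in_path_ops in H as (y & H); lia.
  - constructor; [|apply IH; lia]. intros H.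
    apply in_path_ops in H as (y & H); lia.
Qed.

Lemma phase_ops_NoDup x : x <= n -> NoDup (inserted (phase_ops x)).
Proof.
  induction x as [|x IH]; intros Hx; cbn [phase_ops inserted]; constructor.
  - intros [H|H]; [injection H; lia|].
    apply in_phase_ops in H as (y & H); lia.
  - constructor; [|apply IH; lia]. intros H.
    apply in_phase_ops in H as (y & H); lia.
Qed.

(** Star edges differ in their leaf and genuine arcs in their ordered pair. A pair could recur only
    through a loop, a repeated edge or, for an undirected input, an edge listed in both
    orientations; [simple_graph] forbids all three. *)
Lemma arc_ops_NoDup x : x <= length E -> NoDup (inserted (arc_ops x)).
Proof.
  destruct HE as (Hb & HN & Hr).
  assert (Hin : forall e u v, e < length E -> nth e E (0, 0) = (u, v) ->
            In (u, v) E) by (intros e u v He <-; now apply nth_In).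
  assert (Hneq : forall e e' p, e < length E -> e' < e ->
            nth e E (0, 0) = p -> nth e' E (0, 0) = p -> False).
  { intros e e' p He He' H1 H2.
    assert (e = e'); [|lia].
    apply (proj1 (NoDup_nth E (0, 0)) HN); congruence || lia. }
  assert (Hsw : forall u v, is_undirected h = true ->
            In (u, v) E -> In (v, u) E -> False).
  { intros u v Hu. destruct h; [discriminate|]. now apply Hr. }
  induction x as [|x IH]; intros Hx; cbn [arc_ops]; [constructor|].
  destruct (nth x E (0, 0)) as [u v] eqn:En.
  cbn [inserted ins]. rewrite <- !surjective_pairing.
  assert (I1 : In (u, v) E) by (apply (Hin x); trivial; lia).
  destruct (Hb _ _ I1) as (Bu & Bv & Nuv).
  constructor.
  - intros [H|H].
    + symmetry in H. apply arc_edge_inj in H; trivial. lia.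
    + rewrite (surjective_pairing (arc_edge _ _ _ _)) in H.
      apply in_arc_ops in H as (e & u' & v' & He & Hn & H).
      assert (I2 : In (u', v') E) by (apply (Hin e); trivial; lia).
      destruct (Hb _ _ I2) as (Bu' & Bv' & Nuv').
      rewrite <- surjective_pairing in H.
      destruct H as [H|H]; apply arc_edge_inj in H; trivial;
        destruct H as [H|(-> & -> & Q1 & Q2)]; try lia.
      * now apply (Hneq x e (u', v')).
      * now apply (Hsw v' u').
  - constructor; [|apply IH; lia]. intros H.
    rewrite (surjective_pairing (arc_edge _ _ _ _)) in H.
    apply in_arc_ops in H as (e & u' & v' & He & Hn & H).
    assert (I2 : In (u', v') E) by (apply (Hin e); trivial; lia).
    destruct (Hb _ _ I2) as (Bu' & Bv' & Nuv').
    rewrite <- surjective_pairing in H.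
    destruct H as [H|H]; apply arc_edge_inj in H; trivial;
      destruct H as [H|(-> & -> & Q1 & Q2)]; try lia.
    + now apply (Hsw v' u').
    + now apply (Hneq x e (u', v')).
Qed.

Lemma layered_ops_NoDup : NoDup (inserted layered_ops).
Proof.
  unfold layered_ops. rewrite !inserted_app.
  assert (Harc : forall a b, In (a, b) (inserted (arc_ops (length E))) ->
    (a < n \/ 2 * n <= a < 3 * n) \/ a = 5 * n + 2).
  { intros a b H. apply in_arc_ops in H as (e & u & v & He & Hn & H).
    destruct (nth_adj He Hn) as [A1 _]. destruct (adj_bounds _ _ A1) as [Bu Bv].
    pose proof (source_bound Bu). pose proof (source_bound Bv).
    unfold arc_edge in H.
    destruct (consecutive (col u) (col v)), (consecutive (col v) (col u)),
      (is_undirected h); simpl in H; destruct H as [H|H]; injection H; lia. }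
  apply NoDup_app.
  - now apply path_ops_NoDup.
  - apply NoDup_app.
    + now apply arc_ops_NoDup.
    + now apply phase_ops_NoDup.
    + intros [a b] H1 H2. apply Harc in H1. apply in_phase_ops in H2 as (y & H2).
      lia.
  - intros [a b] H1 H2. apply in_path_ops in H1 as (y & H1).
    apply in_app_or in H2 as [H2|H2].
    + apply Harc in H2. lia.
    + apply in_phase_ops in H2 as (z & H2). lia.
Qed.

Lemma layered_ops_simple : simple_graph g order (inserted layered_ops).
Proof.
  split; [|split].
  - intros a b H. apply layered_ops_edges in H.
    pose proof (layered_edge_bounds H). pose proof (potential_strict H).
    repeat split; try tauto. intros ->. lia.
  - exact layered_ops_NoDup.
  - intros _ a b H1 H2. apply layered_ops_edges, potential_strict in H1, H2.
    lia.
Qed.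

(** * Shortest possible walks and coloured cycles *)

Section Stage.

Variables (X : nat) (F : list edge).
Hypothesis HX : X < n.
Hypothesis HF : stage X F.

Lemma in_adj a b : In (a, b) F -> adj g F a b.
Proof. destruct g; simpl; auto. Qed.

Lemma adj_layered a b :
  adj g F a b -> layered_edge X a b \/ layered_edge X b a.
Proof.
  destruct HF as [H _]. destruct g; simpl; intros Ha; [|destruct Ha]; auto.
Qed.

Lemma potential_walk l a b :
  walk g F l a b -> potential X b <= potential X a + l.
Proof.
  induction 1 as [|l a b c Ha _ IH]; [lia|].
  apply adj_layered in Ha as [H|H]; apply potential_edge in H; lia.
Qed.

(** The length equals the difference of potential to the sink, so there is no slack: every step must
    follow an edge forwards and raise the potential by one. *)
Definition tight (l a : nat) : Prop :=
  walk g F l a (4 * n + 1) /\ 2 * S X + k = potential X a + l.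

Lemma potential_sink : potential X (4 * n + 1) = 2 * S X + k.
Proof.
  replace (4 * n + 1) with (4 * n + 1 + 0) by lia.
  rewrite potential_q by lia. lia.
Qed.

Lemma tight_step l a : tight (S l) a ->
  exists b, layered_edge X a b /\ potential X b = S (potential X a) /\ tight l b.
Proof.
  intros [Hw Hp]. inversion Hw as [|l' a' b c Ha Hw' e1 e2 e3]; subst.
  exists b. pose proof (potential_walk Hw') as Hb. rewrite potential_sink in Hb.
  apply adj_layered in Ha as [H|H]; pose proof (potential_edge H);
    [|lia]. repeat split; trivial; lia.
Qed.

(** An exit leads only to its vertex q_y. For [y < X] that edge is not there yet, and for [y > X] it
    does not raise the potential. *)
Lemma tight_exit l y : y < n -> tight l (n + y) -> y = X.
Proof.
  intros Hy Ht. pose proof (proj2 Ht) as Hl. rewrite potential_exit in Hl by lia.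
  destruct l as [|l]; [lia|].
  destruct (tight_step Ht) as (b & Hb & Hp & _).
  rewrite potential_exit in Hp by lia.
  remember (n + y) as a eqn:Ea.
  destruct Hb as [x Hx|x Hx|u v Ha Hc Hn|i Hi|x Hx|x Hx]; try lia.
  - destruct (adj_bounds _ _ Ha) as [Hu _].
    pose proof (source_bound Hu). lia.
  - rewrite potential_q in Hp by lia. lia.
Qed.

(** Each step moves to the next colour, so following the walk collects one vertex per colour. The
    arc out of colour [k - 1] enters an exit, which [tight_exit] identifies as that of [X]; there
    the cycle closes. *)
Lemma tight_layers j : forall v l, v < n -> col v + S j = k ->
  tight l (source v) ->
  exists f, f (col v) = v /\
    (forall i, col v <= i < k -> col (f i) = i) /\
    (forall i, col v <= i -> S i < k -> adj h E (f i) (f (S i))) /\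
    adj h E (f (k - 1)) X.
Proof.
  induction j as [|j IH]; intros v l Hv Hc Ht;
    pose proof (proj2 Ht) as Hl; rewrite potential_source in Hl by trivial;
    (destruct l as [|l]; [lia|]);
    destruct (tight_step Ht) as (b & Hb & Hp & Htb); clear Hp;
    pose proof (source_bound Hv) as Hs;
    remember (source v) as a eqn:Ea;
    destruct Hb as [x Hx|x Hx|u y Ha Hcu Hn|i Hi|x Hx|x Hx]; try lia;
    destruct (adj_bounds _ _ Ha) as [Hu Hy];
    apply source_inj in Ea; trivial; subst u.
  - assert (Ey : y = X).
    { replace (S (col v)) with k in Hn by lia.
      rewrite Nat.Div0.mod_same in Hn. unfold target in Htb.
      rewrite Hn in Htb. now apply tight_exit in Htb. }
    subst y. exists (fun _ => v). repeat split; trivial; intros; lia.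
  - rewrite Nat.mod_small in Hn by lia.
    assert (Et : target y = source y) by (unfold target, source; now rewrite Hn).
    rewrite Et in Htb. destruct (IH y l) as (f & F1 & F2 & F3 & F4); trivial;
      [lia|].
    exists (fun i => if i =? col v then v else f i).
    rewrite Nat.eqb_refl. repeat split.
    + intros i Hi. destruct (Nat.eqb_spec i (col v)) as [->|]; trivial.
      apply F2. lia.
    + intros i H1 H2. destruct (Nat.eqb_spec (S i) (col v)); [lia|].
      destruct (Nat.eqb_spec i (col v)) as [->|].
      * rewrite <- Hn, F1. trivial.
      * apply F3; lia.
    + destruct (Nat.eqb_spec (k - 1) (col v)); [lia|trivial].
Qed.

Lemma tight_start d : forall x l, x + d = X -> tight l (3 * n + x) ->
  exists l', tight l' X.
Proof.
  induction d as [|d IH]; intros x l Hx Ht;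
    pose proof (proj2 Ht) as Hl; rewrite potential_p in Hl by lia;
    (destruct l as [|l]; [lia|]);
    destruct (tight_step Ht) as (b & Hb & Hp & Htb);
    rewrite potential_p in Hp by lia;
    remember (3 * n + x) as a eqn:Ea;
    destruct Hb as [x' Hx'|x' Hx'|u y Ha Hcu Hn|i Hi|x' Hx'|x' Hx']; try lia;
    try (destruct (adj_bounds _ _ Ha) as [Hu Hy];
         pose proof (source_bound Hu); lia).
  (* Continuing along the path to p_(X+1) is a dead end: its potential is already capped at [S X],
     which is also that of the next path vertex and of every entry, so no further step is tight. *)
  - exfalso. assert (x' = X) by lia. subst x'. clear Hp.
    pose proof (proj2 Htb) as Hl'. rewrite potential_p in Hl' by lia.
    destruct l as [|l]; [lia|].
    destruct (tight_step Htb) as (b & Hb & Hp & _).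
    rewrite potential_p in Hp by lia.
    remember (3 * n + S X) as a' eqn:Ea'.
    destruct Hb as [y Hy|y Hy|u y Ha Hcu Hn|i Hi|y Hy|y Hy]; try lia.
    + rewrite potential_p in Hp by lia. lia.
    + destruct (adj_bounds _ _ Ha) as [Hu Hy].
      pose proof (source_bound Hu). lia.
    + rewrite potential_entry in Hp by lia. lia.
  - assert (x' = X) by lia. subst x'. eauto.
  - assert (x' = x) by lia. subst x'. apply (IH (S x) l); [lia|trivial].
Qed.

Definition coloured_cycle_at (f : nat -> nat) : Prop :=
  f 0 = X /\
  forall i, i < k -> col (f i) = i /\ adj h E (f i) (f (S i mod k)).

Lemma tight_cycle l : tight l (3 * n) -> exists f, coloured_cycle_at f.
Proof.
  intros Ht. replace (3 * n) with (3 * n + 0) in Ht by lia.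
  apply (tight_start X) in Ht as [l' Ht]; [|lia].
  (* An entry has an outgoing edge only as the [source] of a vertex of colour 0. *)
  assert (Hc : col X = 0).
  { pose proof (proj2 Ht) as Hl. rewrite potential_entry in Hl by lia.
    destruct l' as [|l']; [lia|].
    destruct (tight_step Ht) as (b & Hb & _ & _). remember X as a eqn:Ea in Hb at 2.
    destruct Hb as [x Hx|x Hx|u v Ha Hcu Hn|i Hi|x Hx|x Hx]; try lia.
    destruct (adj_bounds _ _ Ha). unfold source in Ea.
    destruct (Nat.eqb_spec (col u) 0) as [e|e]; [congruence|lia]. }
  assert (Es : source X = X) by (unfold source; now rewrite Hc).
  rewrite <- Es in Ht.
  destruct (@tight_layers (k - 1) X l') as (f & F1 & F2 & F3 & F4);
    trivial; [lia|].
  rewrite Hc in *. exists f. split; trivial. intros i Hi. split.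
  - apply F2. lia.
  - destruct (next_colour Hi) as [[H1 ->]|[H1 ->]].
    + rewrite F1. now replace i with (k - 1) by lia.
    + apply F3; lia.
Qed.

Lemma walk_q x : x <= n -> walk g F x (4 * n + 1 + x) (4 * n + 1).
Proof.
  induction x as [|x IH]; intros Hx.
  - rewrite Nat.add_0_r. constructor.
  - econstructor; [|apply IH; lia]. apply in_adj, HF; [apply le_q|]; lia.
Qed.

Lemma walk_layers f j : coloured_cycle_at f -> j < k ->
  walk g F (S j + S X) (source (f (k - S j))) (4 * n + 1).
Proof.
  intros [H0 Hf]. induction j as [|j IH]; intros Hj.
  - destruct (Hf (k - 1)) as [Hc Ha]; [lia|].
    replace (S (k - 1)) with k in Ha by lia.
    rewrite Nat.Div0.mod_same, H0 in Ha.
    destruct (adj_bounds _ _ Ha) as [Hu _].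
    pose proof (source_bound Hu).
    apply walk_cons with (target X).
    + apply in_adj, HF; [|lia]. apply le_arc; trivial; [lia|].
      rewrite <- H0. destruct (Hf 0) as [-> _]; [lia|].
      rewrite Hc. replace (S (k - 1)) with k by lia.
      now rewrite Nat.Div0.mod_same.
    + assert (Hc0 : col X = 0) by (rewrite <- H0; apply Hf; lia).
      unfold target. rewrite Hc0. simpl Nat.eqb. cbv iota.
      apply walk_cons with (4 * n + 1 + X).
      * apply in_adj, HF; [apply le_out|]; lia.
      * apply walk_q. lia.
  - destruct (Hf (k - S (S j))) as [Hc Ha]; [lia|].
    replace (S (k - S (S j))) with (k - S j) in Ha by lia.
    rewrite Nat.mod_small in Ha by lia.
    destruct (adj_bounds _ _ Ha) as [Hu _].
    pose proof (source_bound Hu).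
    destruct (Hf (k - S j)) as [Hc' _]; [lia|].
    replace (S (S j) + S X) with (S (S j + S X)) by lia.
    apply walk_cons with (source (f (k - S j))); [|apply IH; lia].
    assert (Et : source (f (k - S j)) = target (f (k - S j))).
    { unfold source, target. rewrite Hc'.
      destruct (Nat.eqb_spec (k - S j) 0); [lia|trivial]. }
    rewrite Et. apply in_adj, HF; [|lia]. apply le_arc; trivial; [lia|].
    rewrite Hc, Hc'. replace (S (k - S (S j))) with (k - S j) by lia.
    now rewrite Nat.mod_small by lia.
Qed.

Lemma walk_p f d x : coloured_cycle_at f -> x + d = X ->
  walk g F (d + S (k + S X)) (3 * n + x) (4 * n + 1).
Proof.
  intros Hf. revert x. induction d as [|d IH]; intros x Hx.
  - apply walk_cons with X.
    + apply in_adj, HF; [|lia]. replace x with X by lia. apply le_in; lia.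
    + pose proof (@walk_layers f (k - 1) Hf) as Hw.
      replace (S (k - 1)) with k in Hw by lia.
      rewrite Nat.sub_diag in Hw. destruct Hf as [H0 Hf].
      assert (Hc0 : col X = 0) by (rewrite <- H0; apply Hf; lia).
      rewrite H0 in Hw. unfold source in Hw. rewrite Hc0 in Hw.
      apply Hw. lia.
  - apply walk_cons with (3 * n + S x); [|apply IH; lia].
    apply in_adj, HF; [apply le_p|]; lia.
Qed.

(** Keeps the distance 2 X + k + 2 below [order], the code for an infinite distance. *)
Lemma coloured_cycle_length f : coloured_cycle_at f -> k <= n.
Proof.
  intros [_ Hf].
  assert (H : NoDup (map f (seq 0 k))).
  { apply NoDup_map_NoDup_ForallPairs; [|apply seq_NoDup].
    intros i j Hi Hj e. apply in_seq in Hi, Hj.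
    destruct (Hf i) as [<- _]; [lia|]. destruct (Hf j) as [<- _]; [lia|].
    congruence. }
  apply NoDup_incl_length with (l' := seq 0 n) in H.
  - now rewrite length_map, !length_seq in H.
  - intros y Hy. apply in_map_iff in Hy as (i & <- & Hi). apply in_seq in Hi.
    destruct (Hf i) as [_ Ha]; [lia|]. apply adj_bounds in Ha.
    apply in_seq. lia.
Qed.

(** The constant [k] may be large compared with the graph, so 2 X + k + 2 could coincide with the
    code [order] of an infinite distance; the comparison with [order] removes this false hit. *)
Lemma answer_spec a :
  correct_answer g order (3 * n) (4 * n + 1) F a ->
  (a = 2 * X + k + 2 /\ a < order) <-> exists f, coloured_cycle_at f.
Proof.
  assert (Hs : potential X (3 * n) = 0).
  { replace (3 * n) with (3 * n + 0) by lia. now rewrite potential_p by lia. }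
  intros Ha. split.
  - intros [-> Hlt]. destruct Ha as [[Hw _]|[_ He]]; [|lia].
    apply (@tight_cycle (2 * X + k + 2)). split; trivial. lia.
  - intros [f Hf]. pose proof (coloured_cycle_length Hf) as Hkn.
    pose proof (@walk_p f X 0 Hf eq_refl) as Hw.
    rewrite Nat.add_0_r in Hw. unfold order.
    destruct Ha as [[Hw' Hmin]|[Hno _]]; [|now apply Hno in Hw].
    apply Hmin in Hw. apply potential_walk in Hw'.
    rewrite potential_sink in Hw'. lia.
Qed.

End Stage.

(** * Reading the verdict off the answers *)

Definition coloured_cycle : Prop :=
  exists f, forall i, i < k -> col (f i) = i /\ adj h E (f i) (f (S i mod k)).

Fixpoint hits (x : nat) (outs : list nat) : Prop :=
  match x, outs with
  | S x, a :: outs => (a = 2 * x + k + 2 /\ a < order) \/ hits x outs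
  | _, _ => False
  end.

Lemma correct_answers_inserts N s t ops1 : forall ops2 F outs,
  ~ In Query ops1 ->
  correct_answers g N s t F (ops1 ++ ops2) outs ->
  correct_answers g N s t (rev (inserted ops1) ++ F) ops2 outs.
Proof.
  induction ops1 as [|[u v|] ops1 IH]; intros ops2 F outs Hq H; simpl in *.
  - trivial.
  - inversion H; subst. rewrite <- app_assoc. simpl. apply IH; tauto.
  - tauto.
Qed.

Lemma no_query_path x : ~ In Query (path_ops x).
Proof.
  induction x; simpl; [tauto|]. intros [H|[H|H]]; try discriminate; tauto.
Qed.

Lemma no_query_arc x : ~ In Query (arc_ops x).
Proof.
  induction x; simpl; [tauto|]. destruct (nth x E (0, 0)).
  intros [H|[H|H]]; try discriminate; tauto.
Qed.

Lemma hits_phases x : forall F outs, x <= n -> stage x F ->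
  correct_answers g order (3 * n) (4 * n + 1) F (phase_ops x) outs ->
  hits x outs <-> exists y f, y < x /\ coloured_cycle_at y f.
Proof.
  induction x as [|x IH]; intros F outs Hx HF H; simpl.
  - split; [tauto|]. intros (y & f & Hy & _). lia.
  - cbn [phase_ops] in H.
    inversion H as [|? ? ? ? ? H1|]; subst. clear H.
    inversion H1 as [|? ? ? ? ? H2|]; subst. clear H1.
    inversion H2 as [| |? a ? outs' Ha H3]; subst. clear H2.
    assert (HF' := stage_next Hx HF).
    rewrite (answer_spec Hx HF' Ha), (IH _ _ (Nat.lt_le_incl _ _ Hx) HF' H3).
    split.
    + intros [[f Hf]|(y & f & Hy & Hf)]; [exists x, f|exists y, f]; auto.
    + intros (y & f & Hy & Hf). destruct (Nat.eq_dec y x) as [->|];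
        [left; eauto|]. right. exists y, f. split; [lia|trivial].
Qed.

Lemma hits_spec outs :
  correct_answers g order (3 * n) (4 * n + 1) [] layered_ops outs ->
  hits n outs <-> coloured_cycle.
Proof.
  intros H. unfold layered_ops in H. rewrite app_assoc in H.
  apply correct_answers_inserts in H.
  - apply hits_phases in H; trivial.
    + rewrite H. split.
      * intros (y & f & _ & _ & Hf). now exists f.
      * intros [f Hf]. exists (f 0), f. split; [|now split].
        destruct (Hf 0) as [_ Ha]; [lia|]. now apply adj_bounds in Ha.
    + apply stage_initial. intros e. rewrite app_nil_r, <- in_rev. tauto.
  - rewrite in_app_iff. intros [Hq|Hq].
    + now apply no_query_path in Hq.
    + now apply no_query_arc in Hq.
Qed.

End Layered.

(** * Colourings by residues *)

Fixpoint nprod (F : nat -> nat) (n : nat) : nat :=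
  match n with 0 => 1 | S n => nprod F n * F n end.

Lemma nprod_divide F n i : i < n -> Nat.divide (F i) (nprod F n).
Proof.
  induction n as [|n IH]; intros H; [lia|]. simpl.
  destruct (Nat.eq_dec i n) as [->|].
  - apply Nat.divide_factor_r.
  - apply Nat.divide_mul_l, IH. lia.
Qed.

Lemma nprod_pos F n : (forall i, i < n -> 0 < F i) -> 0 < nprod F n.
Proof.
  induction n as [|n IH]; intros H; simpl; [lia|].
  apply Nat.mul_pos_pos; auto.
Qed.

Lemma nprod_le F b n : (forall i, i < n -> F i <= b) -> nprod F n <= b ^ n.
Proof.
  induction n as [|n IH]; intros H; simpl; [lia|].
  rewrite Nat.mul_comm. apply Nat.mul_le_mono; auto.
Qed.

Lemma nprod_ge F b n : (forall i, i < n -> b <= F i) -> b ^ n <= nprod F n.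
Proof.
  induction n as [|n IH]; intros H; simpl; [lia|].
  rewrite (Nat.mul_comm b). apply Nat.mul_le_mono; auto.
Qed.

Lemma coprime_mul a b c :
  Nat.gcd a c = 1 -> Nat.gcd b c = 1 -> Nat.gcd (a * b) c = 1.
Proof.
  intros Ha Hb. set (d := Nat.gcd (a * b) c).
  assert (Hd : Nat.divide d (a * b)) by apply Nat.gcd_divide_l.
  assert (Hc : Nat.divide d c) by apply Nat.gcd_divide_r.
  assert (Hda : Nat.gcd d a = 1).
  { apply Nat.divide_1_r. rewrite <- Ha. apply Nat.gcd_greatest.
    - apply Nat.gcd_divide_r.
    - eapply Nat.divide_trans; [apply Nat.gcd_divide_l|exact Hc]. }
  apply Nat.divide_1_r. rewrite <- Hb. apply Nat.gcd_greatest; trivial.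
  now apply Nat.gauss with (m := a).
Qed.

Lemma coprime_nprod F n c :
  (forall i, i < n -> Nat.gcd (F i) c = 1) -> Nat.gcd (nprod F n) c = 1.
Proof.
  induction n as [|n IH]; intros H; simpl.
  - reflexivity.
  - apply coprime_mul; auto.
Qed.

Lemma nprod_coprime_divide F n D :
  (forall i j, i < j < n -> Nat.gcd (F i) (F j) = 1) ->
  (forall i, i < n -> Nat.divide (F i) D) -> Nat.divide (nprod F n) D.
Proof.
  induction n as [|n IH]; intros Hc Hd; simpl.
  - apply Nat.divide_1_l.
  - destruct IH as [c Ec]; [intros; apply Hc; lia|auto|].
    destruct (Nat.gauss (F n) (nprod F n) c) as [e Ee].
    + rewrite Nat.mul_comm, <- Ec. auto.
    + rewrite Nat.gcd_comm. apply coprime_nprod. intros; apply Hc; lia.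
    + exists e. rewrite Ec, Ee. ring.
Qed.

Lemma divide_fact a n : 1 <= a <= n -> Nat.divide a (fact n).
Proof.
  induction n as [|n IH]; intros H; [lia|].
  change (fact (S n)) with (S n * fact n).
  destruct (Nat.eq_dec a (S n)) as [->|].
  - apply Nat.divide_factor_l.
  - apply Nat.divide_mul_r, IH. lia.
Qed.

(* Goedel's beta function moduli. *)
Definition modulus (M X j : nat) : nat := 1 + S j * (fact M * X).

(** With N = M! X, a common divisor is prime to N and divides N (j - i), hence divides j - i < M,
    hence M! and N; so it is 1. The factor X only serves to make the moduli at least X. *)
Lemma modulus_coprime M X i j :
  i < j < M -> Nat.gcd (modulus M X i) (modulus M X j) = 1.
Proof.
  intros H. unfold modulus. set (N := fact M * X).
  set (d := Nat.gcd (1 + S i * N) (1 + S j * N)).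
  assert (H1 : Nat.divide d (1 + S i * N)) by apply Nat.gcd_divide_l.
  assert (H2 : Nat.divide d (1 + S j * N)) by apply Nat.gcd_divide_r.
  assert (HN : Nat.gcd d N = 1).
  { apply Nat.divide_1_r. apply Nat.divide_add_cancel_r with (m := S i * N).
    - apply Nat.divide_mul_r, Nat.gcd_divide_r.
    - rewrite Nat.add_comm. eapply Nat.divide_trans; [apply Nat.gcd_divide_l|].
      exact H1. }
  assert (H3 : Nat.divide d (N * (j - i))).
  { apply Nat.divide_add_cancel_r with (m := 1 + S i * N); trivial.
    now replace (1 + S i * N + N * (j - i)) with (1 + S j * N) by nia. }
  apply Nat.gauss in H3; [|now rewrite Nat.gcd_comm in HN; rewrite Nat.gcd_comm].
  apply Nat.divide_1_r. rewrite <- HN. apply Nat.gcd_greatest.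
  - apply Nat.divide_refl.
  - eapply Nat.divide_trans; [exact H3|]. apply Nat.divide_mul_l, divide_fact.
    lia.
Qed.

Lemma mod_eq_divide a b q : b <= a -> a mod q = b mod q -> Nat.divide q (a - b).
Proof.
  intros H e. exists (a / q - b / q).
  pose proof (Nat.div_mod_eq a q). pose proof (Nat.div_mod_eq b q).
  rewrite Nat.mul_sub_distr_r. nia.
Qed.

Lemma separating_modulus (f : nat -> nat) (k L m X : nat) :
  let M := S L * (k * k) in
  1 <= k -> 2 <= X -> m < X ^ L ->
  (forall i, i < k -> f i < 2 * m) ->
  (forall i j, i < k -> j < k -> f i = f j -> i = j) ->
  exists q, 1 <= q < (M * fact M + 2) * X /\
    forall i j, i < k -> j < k -> f i mod q = f j mod q -> i = j.
Proof.
  intros M Hk HX HL Hb Hinj. apply NNPP. intros Hno.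
  (* One of the two truncated differences vanishes, so the sum is the absolute difference; the value
     1 on the diagonal keeps the product nonzero. *)
  set (dd := fun i j => if i =? j then 1 else (f i - f j) + (f j - f i)).
  set (D := nprod (fun i => nprod (dd i) k) k).
  assert (Hdd : forall i j, i < k -> j < k -> 0 < dd i j <= 2 * m).
  { intros i j Hi Hj. unfold dd. pose proof (Hb _ Hi). pose proof (Hb _ Hj).
    destruct (Nat.eqb_spec i j); [lia|].
    assert (f i <> f j) by auto. lia. }
  assert (HD : 0 < D).
  { apply nprod_pos. intros i Hi. apply nprod_pos. intros j Hj.
    now apply Hdd. }
  assert (HDle : D <= (2 * m) ^ (k * k)).
  { rewrite Nat.pow_mul_r. apply nprod_le. intros i Hi. apply nprod_le.
    intros j Hj. now apply Hdd. }
  assert (Hdiv : Nat.divide (nprod (modulus M X) M) D).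
  { apply nprod_coprime_divide; [apply modulus_coprime|].
    intros l Hl. apply NNPP. intros Hnd. apply Hno. exists (modulus M X l).
    split.
    - unfold modulus. split; [lia|].
      assert (S l * (fact M * X) <= M * (fact M * X))
        by (apply Nat.mul_le_mono_r; lia). lia.
    - intros i j Hi Hj e. apply NNPP. intros Hij. apply Hnd.
      assert (Hq : Nat.divide (modulus M X l) (dd i j)).
      { unfold dd. destruct (Nat.eqb_spec i j); [tauto|].
        destruct (Nat.le_ge_cases (f i) (f j)).
        - replace (f i - f j + (f j - f i)) with (f j - f i) by lia.
          now apply mod_eq_divide.
        - replace (f i - f j + (f j - f i)) with (f i - f j) by lia.
          now apply mod_eq_divide. }
      eapply Nat.divide_trans; [exact Hq|].
      eapply Nat.divide_trans; [apply (@nprod_divide (dd i) k j Hj)|].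
      apply (@nprod_divide (fun i => nprod (dd i) k) k i Hi). }
  apply Nat.divide_pos_le in Hdiv; trivial.
  assert (Hge : X ^ M <= nprod (modulus M X) M).
  { apply nprod_ge. intros i Hi. unfold modulus.
    pose proof (lt_O_fact M). nia. }
  (* From m < X^L and 2 <= X follows 2 m < X^(L+1); hence the factor [S L] in [M]. *)
  assert (Hlt : (2 * m) ^ (k * k) < X ^ M).
  { unfold M. rewrite (Nat.pow_mul_r X). apply Nat.pow_lt_mono_l; [nia|].
    simpl. nia. }
  lia.
Qed.

(** Mirrors the machine loop [colour_body], whose invariant can then be an equation. The lowest
    digit belongs to the largest colour, and a later match overwrites an earlier one. *)
Fixpoint colour_loop (Q a i y acc : nat) : nat :=
  match i with
  | 0 => acc
  | S i => colour_loop Q a i (y / Q) (if y mod Q =? a then i else acc)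
  end.

(* A trial number encodes a modulus and one residue for each colour, in
   base [Q]; colour [k] means no colour. *)
Definition colour (k Q Z v : nat) : nat :=
  colour_loop Q (v mod (Z mod Q)) k (Z / Q) k.

Fixpoint encode (Q : nat) (d : nat -> nat) (i : nat) : nat :=
  match i with 0 => 0 | S i => d i + Q * encode Q d i end.

Lemma encode_bound Q d i : (forall j, j < i -> d j < Q) -> encode Q d i < Q ^ i.
Proof.
  induction i as [|i IH]; intros H; simpl; [lia|].
  assert (d i < Q) by auto. assert (encode Q d i < Q ^ i) by auto. nia.
Qed.

Lemma colour_loop_encode Q d i : (forall j, j < i -> d j < Q) ->
  forall i0 acc, (forall j, j < i -> d j = d i0 -> j = i0) ->
  colour_loop Q (d i0) i (encode Q d i) acc = if i0 <? i then i0 else acc.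
Proof.
  induction i as [|i IH]; intros H i0 acc Hinj; trivial.
  cbn [colour_loop encode].
  assert (Hd : d i < Q) by auto.
  rewrite (Nat.mul_comm Q), Nat.Div0.mod_add, Nat.mod_small by trivial.
  rewrite Nat.div_add, Nat.div_small, Nat.add_0_l by lia.
  rewrite IH by auto.
  destruct (Nat.eqb_spec (d i) (d i0)) as [e|e].
  - apply Hinj in e; [|lia]. subst i0.
    destruct (Nat.ltb_spec i i), (Nat.ltb_spec i (S i)); lia.
  - assert (i0 <> i) by congruence.
    destruct (Nat.ltb_spec i0 i), (Nat.ltb_spec i0 (S i)); lia.
Qed.

(** Different positions carry different colours, so the vertices are distinct. Thus no colouring
    gives a false positive, not even one from a meaningless trial number. *)
Lemma coloured_cycle_sound h k E col :
  min_cycle_length h <= k -> coloured_cycle h k E col -> has_cycle h k E.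
Proof.
  intros Hk [f Hf]. split; trivial. exists f. split.
  - intros i j Hi Hj e. destruct (Hf i Hi) as [<- _], (Hf j Hj) as [<- _].
    congruence.
  - intros i Hi. now apply Hf.
Qed.

Lemma has_cycle_coloured h n k E L m X :
  let M := S L * (k * k) in
  let Q := (M * fact M + 2) * X in
  2 <= k -> 2 <= X -> m < X ^ L -> n <= 2 * m -> simple_graph h n E ->
  has_cycle h k E ->
  exists Z, Z < Q ^ S k /\ coloured_cycle h k E (colour k Q Z).
Proof.
  intros M Q Hk HX HL Hn HE [_ (f & Hinj & Hadj)].
  destruct (@separating_modulus f k L m X) as (q & Hq & Hsep); trivial; [lia| |].
  { intros i Hi. apply Hadj in Hi. apply (adj_bounds HE) in Hi. lia. }
  fold M in Hq. fold Q in Hq.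
  set (d := fun i => f i mod q).
  assert (Hd : forall i, d i < Q).
  { intros i. unfold d. pose proof (Nat.mod_upper_bound (f i) q). lia. }
  pose proof (@encode_bound Q d k (fun j _ => Hd j)) as Hb.
  (* The lowest digit is the modulus and the other [k] digits are the residues of the cycle
     vertices. *)
  exists (q + encode Q d k * Q). split.
  - rewrite Nat.pow_succ_r'. nia.
  - exists f. intros i Hi. split; [|now apply Hadj].
    unfold colour.
    rewrite Nat.Div0.mod_add, (Nat.mod_small q) by lia.
    rewrite Nat.div_add, (Nat.div_small q), Nat.add_0_l by lia.
    change (f i mod q) with (d i). rewrite colour_loop_encode.
    + apply Nat.ltb_lt in Hi. now rewrite Hi.
    + auto.
    + intros j Hj. now apply Hsep.
Qed.

(** * The algorithm *)

(* Registers: 0 and 1 hold [n] and [m], 2 and 3 the numbers of edges and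
   vertices of the layered graph, 5 the base [Q], 6 the trial number, 9 the
   verdict, 10 the counter of the loops inside a trial, 24 the constant 1. *)

Definition decrement (r : nat) : cmd := Cst 24 1 ;; Bin Sub r r 24.

Definition insert_cmd (D : data_structure) (r1 r2 : nat) : cmd :=
  Bin Or (dreg 0) r1 r1 ;; Bin Or (dreg 1) r2 r2 ;; Sim (on_insert D).

Definition path_body (D : data_structure) : cmd :=
  decrement 10 ;;
  Cst 18 3 ;; Bin Mul 18 18 0 ;; Bin Add 18 18 10 ;; Bin Add 19 18 24 ;;
  insert_cmd D 18 19 ;;
  Cst 20 4 ;; Bin Mul 20 20 0 ;; Bin Add 20 20 24 ;; Bin Add 20 20 10 ;;
  Bin Add 21 20 24 ;;
  insert_cmd D 21 20.

Definition colour_body (rout : nat) : cmd :=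
  decrement 15 ;;
  Bin Mod 18 16 5 ;; Bin Eq 18 18 17 ;; Bin Div 16 16 5 ;;
  If 18 (Bin Or rout 15 15) Skip.

Definition colour_cmd (k rin rout : nat) : cmd :=
  Bin Div 16 6 5 ;; Bin Mod 17 6 5 ;; Bin Mod 17 rin 17 ;;
  Cst rout k ;; Cst 15 k ;;
  While 15 (colour_body rout).

(** Conditions are products of numbers 0 and 1, and an offset is such a number times [n]. Both
    branches leave their edge in registers 21 and 22, so the insertion is compiled once. *)
Definition arc_cmd (D : data_structure) (k : nat) (b : bool)
    (ru rcu rv rcv i : nat) : cmd :=
  Cst 18 k ;; Bin Lt 19 rcu 18 ;;
  Cst 24 1 ;; Bin Add 20 rcu 24 ;; Bin Mod 20 20 18 ;; Bin Eq 20 20 rcv ;;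
  Bin Mul 19 19 20 ;; Cst 20 (if b then 1 else 0) ;; Bin Mul 19 19 20 ;;
  Cst 23 0 ;;
  If 19
    (Bin Lt 20 23 rcu ;; Bin Mul 20 20 0 ;;
     Bin Add 21 ru 20 ;; Bin Add 21 21 20 ;;
     Bin Lt 20 23 rcv ;; Bin Mul 20 20 0 ;;
     Bin Add 22 rv 20 ;; Bin Add 22 22 0)
    (Cst 20 5 ;; Bin Mul 20 20 0 ;; Cst 21 2 ;; Bin Add 21 20 21 ;;
     Cst 22 (3 + i) ;; Bin Add 22 22 20 ;; Bin Add 22 22 10 ;;
     Bin Add 22 22 10) ;;
  insert_cmd D 21 22.

Definition edge_body (D : data_structure) (k : nat) (h : graph_kind) : cmd :=
  decrement 10 ;;
  Bin Add 18 10 10 ;; Get 11 18 ;; Bin Add 18 18 24 ;; Get 12 18 ;;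
  colour_cmd k 11 13 ;; colour_cmd k 12 14 ;;
  arc_cmd D k true 11 13 12 14 0 ;;
  arc_cmd D k (is_undirected h) 12 14 11 13 1.

Definition phase_body (D : data_structure) (k : nat) : cmd :=
  decrement 10 ;;
  Cst 18 3 ;; Bin Mul 18 18 0 ;; Bin Add 18 18 10 ;;
  insert_cmd D 18 10 ;;
  Bin Add 18 0 10 ;;
  Cst 19 4 ;; Bin Mul 19 19 0 ;; Bin Add 19 19 24 ;; Bin Add 19 19 10 ;;
  insert_cmd D 18 19 ;;
  Sim (on_query D) ;;
  Cst 18 (k + 2) ;; Bin Add 18 18 10 ;; Bin Add 18 18 10 ;;
  Bin Eq 18 (dreg 0) 18 ;; Bin Lt 19 (dreg 0) 3 ;; Bin Mul 18 18 19 ;;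
  Bin Or 9 9 18.

Fixpoint clear_cmd (b : nat) : cmd :=
  match b with 0 => Skip | S b => Cst (dreg b) 0 ;; clear_cmd b end.

(** Block 0 of 2^w' words contains the input, so trial [Z] works in block [Z + 1]. Only registers
    have to be cleared, as the block is still blank. *)
Definition trial_cmd (D : data_structure) (B k : nat) (h : graph_kind) : cmd :=
  decrement 6 ;;
  Bin Add 7 6 24 ;; Bin Mul 7 7 4 ;;
  clear_cmd B ;;
  Bin Or (dreg 0) 3 3 ;; Bin Or (dreg 1) 2 2 ;;
  Cst 18 3 ;; Bin Mul (dreg 2) 18 0 ;;
  Cst 18 4 ;; Bin Mul 18 18 0 ;; Bin Add (dreg 3) 18 24 ;;
  Sim (preprocess D) ;;
  Bin Or 10 0 0 ;; While 10 (path_body D) ;;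
  Bin Or 10 1 1 ;; While 10 (edge_body D k h) ;;
  Bin Or 10 0 0 ;; While 10 (phase_body D k).

Ltac registers :=
  cbn [upd Nat.eqb dreg Nat.add];
  repeat match goal with
    H : ?f ?r = _ |- context [?f ?r] => is_var f; rewrite H
  end.

Ltac evaluate :=
  registers;
  first [ apply ev_add | apply ev_mul | apply ev_sub | apply ev_div
        | apply ev_mod | apply ev_lt | apply ev_eq | apply ev_move
        | apply Nat.mod_small ];
  try reflexivity; cbn [andb]; try lia.

Tactic Notation "step" uconstr(x) :=
  apply wp_seq;
  first [ apply wp_cst with (v := x) | apply wp_bin with (v := x)
        | apply wp_get with (v := x) ];
  [ try (evaluate; fail) | ].

Lemma colour_loop_le Q a i : forall y acc b,
  acc <= b -> i <= b -> colour_loop Q a i y acc <= b.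
Proof.
  induction i as [|i IH]; intros y acc b H1 H2; simpl; trivial.
  apply IH; [|lia]. destruct (y mod Q =? a); lia.
Qed.

Lemma colour_le k Q Z z : colour k Q Z z <= k.
Proof. apply colour_loop_le; lia. Qed.

(** * Correctness and cost of one trial *)

Section Trial.

Variables (w v : nat) (D : data_structure) (B : nat) (h g : graph_kind).
Variables (n k Q Z : nat) (E : list edge) (input : nat -> nat) (budget : nat).

Let base := S Z * 2 ^ v.
Let m := length E.
Let col := colour k Q Z.

Hypothesis Hvw : v <= w.
Hypothesis Hbase : base + 2 ^ v < 2 ^ w.
Hypothesis Hsize : 2 * (2 * m + 4 * n) < 2 ^ v.
Hypothesis Hn : 1 <= n.
Hypothesis Hkw : k + 2 + 2 ^ v < 2 ^ w.
Hypothesis HQ : Q < 2 ^ w.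
Hypothesis HB : 4 <= B.
Hypothesis HDp : Forall (regs_below B) (preprocess D).
Hypothesis HDi : Forall (regs_below B) (on_insert D).
Hypothesis HDq : Forall (regs_below B) (on_query D).
Hypothesis HE : simple_graph h n E.
Hypothesis Hinput : forall e u u', e < m -> nth e E (0, 0) = (u, u') ->
  input (2 * e) = u /\ input (2 * e + 1) = u'.

Definition env (rg mm : nat -> nat) : Prop :=
  rg 0 = n /\ rg 1 = m /\ rg 2 = 2 * m + 4 * n /\ rg 3 = order n E /\
  rg 5 = Q /\ rg 6 = Z /\ forall a, a < base -> mm a = input a.

(** The time bound is amortized, so no single operation has a bound of its own. The invariant
    therefore carries the steps [T] that all remaining operations will take, doubled for the
    simulation, and [slack] pays for the surrounding instructions. *)
Definition live (ops : list operation) (outs : list nat) (slack : nat)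
    (rg mm : nat -> nat) (t : nat) : Prop :=
  exists st T, serves v D st ops outs T /\ simulates v B base st rg mm /\
    t + 2 * T + slack <= budget.

Lemma live_same ops outs s s' rg rg' mm t t' :
  live ops outs s rg mm t ->
  (forall r, r = 4 \/ r = 7 \/ 32 <= r -> rg' r = rg r) ->
  t' + s' <= t + s -> live ops outs s' rg' mm t'.
Proof.
  intros (st & T & H1 & (H4 & H7 & HR & HM) & H3) Hr Ht.
  exists st, T. split; [trivial|split; [|lia]].
  repeat split; rewrite ?Hr by (unfold dreg; lia); trivial.
  all: try now apply HR. all: try now apply HM.
Qed.

Lemma env_framed rg mm rg' mm' :
  env rg mm -> framed base rg mm rg' mm' -> env rg' mm'.
Proof.
  intros (H0 & H1 & H2 & H3 & H5 & H6 & HM) [F1 F2].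
  repeat split; try (rewrite F1 by lia; trivial).
  intros a Ha. rewrite F2; auto.
Qed.

Lemma env_same rg mm rg' :
  env rg mm ->
  (forall r, r < 7 -> rg' r = rg r) -> env rg' mm.
Proof.
  intros (H0 & H1 & H2 & H3 & H5 & H6 & HM) F1.
  repeat split; try (rewrite F1 by lia; trivial). trivial.
Qed.

Lemma wp_insert r1 r2 a b ops outs s (P : assertion) rg mm t :
  rg r1 = a -> rg r2 = b -> r1 < 32 -> r2 < 32 -> a < 2 ^ v -> b < 2 ^ v ->
  live (Insert a b :: ops) outs (2 + s) rg mm t ->
  (forall rg' mm' t', framed base rg mm rg' mm' ->
     live ops outs s rg' mm' t' -> P rg' mm' t') ->
  wp w (insert_cmd D r1 r2) P rg mm t.
Proof.
  intros E1 E2 L1 L2 La Lb (st & T & Hs & (H4 & H7 & HR & HM) & Ht) HP.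
  inversion Hs as [|? ? ? T1 st' ? ? T2 Hh Hs'|]; subst. clear Hs.
  pose proof (pow2_pos v).
  unfold insert_cmd. apply wp_seq. apply wp_bin with (v := rg r1).
  { apply ev_move. lia. }
  apply wp_seq. apply wp_bin with (v := rg r2).
  { rewrite upd_other by (unfold dreg; lia). apply ev_move. lia. }
  eapply wp_sim with (B := B) (base := base); eauto.
  - repeat split; trivial.
    + destruct r as [|[|r]]; trivial. simpl.
      destruct r; exact (proj1 (HR _ H0)).
    + destruct r as [|[|r]]; trivial. simpl.
      destruct r; exact (proj2 (HR _ H0)).
    + now apply HM.
    + now apply HM.
  - intros rg' mm' t' Ht' Hsim [F1 F2]. apply HP.
    + split; trivial. intros r Hr1 Hr2. rewrite F1 by trivial.
      rewrite !upd_other by (unfold dreg; lia). trivial.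
    + exists st', T2. split; [trivial|split; [trivial|lia]].
Qed.

Ltac unfold_env :=
  match goal with
  | H : env ?rg ?mm |- _ =>
      let H0 := fresh "E0" in let H1 := fresh "E1" in let H2 := fresh "E2" in
      let H3 := fresh "E3" in let H5 := fresh "E5" in let H6 := fresh "E6" in
      pose proof H as (H0 & H1 & H2 & H3 & H5 & H6 & _)
  end.

Ltac same := intros; repeat rewrite upd_other by lia; reflexivity.

Tactic Notation "insertion" uconstr(a') uconstr(b') uconstr(s') hyp(Hl) :=
  eapply wp_insert with (a := a') (b := b') (s := s');
  [ registers; reflexivity | registers; reflexivity | lia | lia | lia | lia
  | eapply live_same; [exact Hl | same | lia] | clear Hl ].

Ltac track F Henv :=
  match type of F with
  | framed _ _ _ ?rg' ?mm' =>
      let H := fresh "Henv" in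
      assert (H : env rg' mm')
        by (eapply env_framed; [|exact F]; eapply env_same; [exact Henv|same]);
      clear Henv; rename H into Henv
  end.

Tactic Notation "tracking" hyp(F) constr(r) uconstr(x) :=
  match type of F with
  | framed _ _ _ ?rg' ?mm' =>
      assert (rg' r = x)
        by (rewrite (proj1 F) by lia; registers; reflexivity || assumption)
  end.

Lemma path_loop outs tail s x rg mm t (P : assertion) :
  x <= n -> env rg mm -> rg 10 = x ->
  live (path_ops n x ++ tail) outs (20 * x + s + 1) rg mm t ->
  (forall rg' mm' t', env rg' mm' -> rg' 9 = rg 9 ->
     live tail outs s rg' mm' t' -> P rg' mm' t') ->
  wp w (While 10 (path_body D)) P rg mm t.
Proof.
  intros Hx Henv Hr Hl HP. pose proof (pow2_pos v) as Hpos.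
  apply wp_while with (x := x) (Inv := fun x rg' mm' t' =>
    x <= n /\ env rg' mm' /\ rg' 9 = rg 9 /\
    live (path_ops n x ++ tail) outs (20 * x + s + 1) rg' mm' t'); auto.
  - clear x Hx Henv Hr Hl HP.
    intros x rg1 mm1 t1 (Hx & Henv & H9 & Hl) H10.
    unfold_env. cbn [path_ops app] in Hl.
    unfold path_body, decrement. apply wp_seq.
    step 1. apply wp_bin with (v := x); [evaluate|].
    step 3. step (3 * n). step (3 * n + x). step (3 * n + S x).
    apply wp_seq. insertion _ _ (20 * x + s + 10) Hl.
    intros rg2 mm2 t2 F Hl. track F Henv.
    tracking F 9 (rg 9). tracking F 10 x. tracking F 24 1.
    clear F E0 E1 E2 E3 E5 E6. unfold_env.
    step 4. step (4 * n). step (4 * n + 1). step (4 * n + 1 + x).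
    step (4 * n + 1 + S x).
    insertion _ _ (20 * x + s + 2) Hl.
    intros rg3 mm3 t3 F Hl. track F Henv.
    tracking F 9 (rg 9). tracking F 10 x.
    repeat split; trivial; try apply Henv; try lia.
    eapply live_same; [exact Hl|same|lia].
  - clear Hx Henv Hr Hl.
    intros rg1 mm1 t1 (Hx & Henv & H9 & Hl) H10. apply HP; trivial.
    eapply live_same; [exact Hl|same|lia].
Qed.

Lemma colour_loop_cmd rin rout z rg mm t (P : assertion) :
  11 <= rin < 15 -> 11 <= rout < 15 -> env rg mm -> rg rin = z -> z < 2 ^ w ->
  (forall rg' t',
     (forall r, r <> 15 -> r <> 16 -> r <> 17 -> r <> 18 -> r <> 24 ->
        r <> rout -> rg' r = rg r) ->
     rg' rout = col z -> t' <= t + 12 * k + 10 -> P rg' mm t') ->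
  wp w (colour_cmd k rin rout) P rg mm t.
Proof.
  intros Hin Hout Henv Hr Hz HP. unfold_env. pose proof (pow2_pos v) as Hpos.
  assert (HZ : Z < 2 ^ w).
  { assert (S Z * 1 <= base) by (apply Nat.mul_le_mono_l; lia). lia. }
  assert (Hdiv : forall a b, a < 2 ^ w -> a / b < 2 ^ w).
  { intros a b Ha. destruct b; [simpl; lia|].
    pose proof (Nat.Div0.div_le_upper_bound a (S b) a). nia. }
  unfold colour_cmd.
  step (Z / Q). step (Z mod Q). step (z mod (Z mod Q)).
  { rewrite !upd_other by lia. rewrite upd_same. rewrite Hr. now apply ev_mod. }
  step k. step k.
  set (a := z mod (Z mod Q)).
  eapply wp_while with (x := k) (Inv := fun x rg' mm' t' =>
    mm' = mm /\
    (forall r, r <> 15 -> r <> 16 -> r <> 17 -> r <> 18 -> r <> 24 ->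
        r <> rout -> rg' r = rg r) /\
    rg' 17 = a /\ rg' 16 < 2 ^ w /\
    colour_loop Q a x (rg' 16) (rg' rout) = col z /\
    x <= k /\ t' + 12 * x <= t + 12 * k + 9).
  - intros x rg1 mm1 t1 (-> & Hs & H17 & H16 & Hc & Hx & Ht) H15.
    assert (E5' : rg1 5 = Q) by (rewrite Hs; lia || trivial).
    unfold colour_body, decrement. apply wp_seq. step 1.
    apply wp_bin with (v := x); [evaluate|].
    step (rg1 16 mod Q). step (if rg1 16 mod Q =? a then 1 else 0).
    step (rg1 16 / Q).
    cbn [colour_loop] in Hc.
    apply wp_if.
    + registers. intros Hnz. apply wp_bin with (v := x); [evaluate|].
      destruct (Nat.eqb_spec (rg1 16 mod Q) a); [|tauto].
      split; [|rewrite upd_other by lia; registers; reflexivity].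
      split; [trivial|]. split.
      { intros r R1 R2 R3 R4 R5 R6. rewrite !upd_other by lia. now apply Hs. }
      rewrite upd_same. rewrite !(upd_other _ (a := rout)) by lia.
      repeat split; registers; trivial; try lia. now apply Hdiv.
    + registers. intros Hnz. apply wp_skip.
      destruct (Nat.eqb_spec (rg1 16 mod Q) a); [discriminate|].
      split; [|registers; reflexivity].
      split; [trivial|]. split.
      { intros r R1 R2 R3 R4 R5 R6. rewrite !upd_other by lia. now apply Hs. }
      rewrite !(@upd_other _ _ _ rout) by lia.
      repeat split; registers; trivial; try lia. now apply Hdiv.
  - intros rg1 mm1 t1 (-> & Hs & H17 & H16 & Hc & Hx & Ht) H15.
    apply HP; trivial. lia.
  - split; [trivial|]. split.
    { intros r R1 R2 R3 R4 R5 R6. now rewrite !upd_other by lia. }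
    rewrite (@upd_other _ 15 _ rout), upd_same by lia.
    rewrite !(@upd_other _ _ _ 16), upd_same by lia.
    rewrite !(@upd_other _ _ _ 17), upd_same by lia.
    repeat split; trivial; try lia. now apply Hdiv.
  - apply upd_same.
Qed.

Lemma wp_arc b ru rcu rv rcv i a c x ops outs s rg mm t (P : assertion) :
  (ru, rcu, rv, rcv) = (11, 13, 12, 14) \/ (ru, rcu, rv, rcv) = (12, 14, 11, 13) ->
  env rg mm -> rg ru = a -> rg rv = c -> a < n -> c < n ->
  rg rcu = col a -> rg rcv = col c -> rg 10 = x -> x < m -> i <= 1 ->
  live (ins (arc_edge n k col b (2 * x + i) a c) :: ops) outs (24 + s) rg mm t ->
  (forall rg' mm' t', env rg' mm' ->
     (forall r, 9 <= r < 15 -> rg' r = rg r) ->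
     live ops outs s rg' mm' t' -> P rg' mm' t') ->
  wp w (arc_cmd D k b ru rcu rv rcv i) P rg mm t.
Proof.
  intros Hregs Henv Ha Hc La Lc Hca Hcc H10 Hx Hi Hl HP.
  pose proof (pow2_pos v) as Hpos. unfold_env.
  assert (Ba : col a <= k) by apply colour_le.
  assert (Bc : col c <= k) by apply colour_le.
  set (e := arc_edge n k col b (2 * x + i) a c) in *.
  (* The common end of both branches. Of the slack 24, computing the edge uses at most 22 and moving
     the two arguments uses 2. *)
  assert (Hins : forall rg' t',
    (forall r, r < 15 \/ 32 <= r -> rg' r = rg r) ->
    rg' 21 = fst e -> rg' 22 = snd e -> t' <= t + 22 ->
    wp w (insert_cmd D 21 22) P rg' mm t').
  { intros rg' t' Hsame H21 H22 Ht.
    assert (Hb : fst e < 2 ^ v /\ snd e < 2 ^ v).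
    { unfold e, arc_edge. pose proof (source_bound col La).
      pose proof (target_bound col Lc).
      destruct (b && consecutive k (col a) (col c)); simpl; lia. }
    eapply wp_insert with (s := s); [exact H21|exact H22|lia|lia|lia|lia| |].
    - eapply live_same; [exact Hl| |lia]. intros r Hr. apply Hsame. lia.
    - intros rg2 mm2 t2 F Hl2. apply HP; trivial.
      + eapply env_framed; [|exact F]. eapply env_same; [exact Henv|].
        intros r Hr. apply Hsame. lia.
      + intros r Hr. rewrite (proj1 F) by lia. apply Hsame. lia. }
  clear HP Hl.
  set (cond := b && consecutive k (col a) (col c)) in *.
  unfold arc_cmd.
  destruct Hregs as [Hregs|Hregs]; injection Hregs as -> -> -> ->.
  all: step k; step (if col a <? k then 1 else 0); step 1; step (S (col a));
    step (S (col a) mod k); step (if S (col a) mod k =? col c then 1 else 0).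
  all: step (if consecutive k (col a) (col c) then 1 else 0);
    [ unfold consecutive; destruct (col a <? k), (S (col a) mod k =? col c);
      evaluate | ].
  all: step (if b then 1 else 0); [destruct b; evaluate|].
  all: step (if cond then 1 else 0);
    [ unfold cond; destruct b, (consecutive k (col a) (col c)); evaluate | ].
  all: step 0.
  all: apply wp_seq, wp_if; registers; intros Hcond.
  all: destruct cond eqn:Econd; try tauto; try discriminate.
  all: assert (He : e = if cond then (source n col a, target n col c)
         else (5 * n + 2, 5 * n + 3 + (2 * x + i))) by reflexivity;
       rewrite Econd in He; clear Hcond.
  1,3: step (if 0 <? col a then 1 else 0);
    step ((if 0 <? col a then 1 else 0) * n);
      [destruct (0 <? col a); evaluate|];
    step (a + (if 0 <? col a then 1 else 0) * n);
      [destruct (0 <? col a); evaluate|];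
    step (source n col a);
      [ unfold source;
        destruct (Nat.eqb_spec (col a) 0), (Nat.ltb_spec 0 (col a));
        try lia; evaluate | ];
    step (if 0 <? col c then 1 else 0);
    step ((if 0 <? col c then 1 else 0) * n);
      [destruct (0 <? col c); evaluate|];
    step (c + (if 0 <? col c then 1 else 0) * n);
      [destruct (0 <? col c); evaluate|];
    apply wp_bin with (v := target n col c);
      [ unfold target;
        destruct (Nat.eqb_spec (col c) 0), (Nat.ltb_spec 0 (col c));
        try lia; evaluate | ].
  3,4: step 5; step (5 * n); step 2; step (5 * n + 2);
    step (3 + i); step (3 + i + 5 * n); step (3 + i + 5 * n + x);
    apply wp_bin with (v := 5 * n + 3 + (2 * x + i)); [evaluate|].
  all: apply Hins; [same|rewrite He; reflexivity|rewrite He; reflexivity|lia].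
Qed.

Lemma edge_loop outs tail s x rg mm t (P : assertion) :
  x <= m -> env rg mm -> rg 10 = x ->
  live (arc_ops h n k E col x ++ tail) outs ((24 * k + 90) * x + s + 1) rg mm t ->
  (forall rg' mm' t', env rg' mm' -> rg' 9 = rg 9 ->
     live tail outs s rg' mm' t' -> P rg' mm' t') ->
  wp w (While 10 (edge_body D k h)) P rg mm t.
Proof.
  intros Hx Henv Hr Hl HP. pose proof (pow2_pos v) as Hpos.
  apply wp_while with (x := x) (Inv := fun x rg' mm' t' =>
    x <= m /\ env rg' mm' /\ rg' 9 = rg 9 /\
    live (arc_ops h n k E col x ++ tail) outs ((24 * k + 90) * x + s + 1)
      rg' mm' t'); auto.
  - clear x Hx Henv Hr Hl HP.
    intros x rg1 mm1 t1 (Hx & Henv & H9 & Hl) H10.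
    unfold_env. cbn [arc_ops] in Hl.
    destruct (nth x E (0, 0)) as [a c] eqn:En. cbn [app] in Hl.
    destruct (Hinput Hx En) as [I1 I2].
    assert (Lac : a < n /\ c < n).
    { assert (Hin : In (a, c) E) by (rewrite <- En; now apply nth_In).
      apply (proj1 HE) in Hin. tauto. }
    destruct Lac as [La Lc].
    (* The block of a trial starts at 2^v or later, so the simulation has not touched the input. *)
    assert (Hm : forall y, y < 2 ^ v -> mm1 y = input y).
    { intros y Hy. apply Henv. unfold base. simpl. lia. }
    unfold edge_body, decrement. apply wp_seq.
    step 1. apply wp_bin with (v := x); [evaluate|].
    step (2 * x). step a; [registers; rewrite Hm by lia; trivial|].
    step (2 * x + 1). step c; [registers; rewrite Hm by lia; trivial|].
    apply wp_seq.
    eapply colour_loop_cmd with (z := a); [lia|lia| |registers; reflexivity|lia|].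
    { eapply env_same; [exact Henv|same]. }
    intros rg2 t2 S2 C2 T2.
    assert (Henv2 : env rg2 mm1).
    { eapply env_same; [exact Henv|]. intros r Hr. rewrite S2 by lia. same. }
    apply wp_seq.
    eapply colour_loop_cmd with (z := c);
      [lia|lia|exact Henv2| |lia|].
    { rewrite S2 by lia. registers. reflexivity. }
    intros rg3 t3 S3 C3 T3.
    assert (Henv3 : env rg3 mm1).
    { eapply env_same; [exact Henv2|]. intros r Hr. now rewrite S3 by lia. }
    apply wp_seq.
    eapply wp_arc with (x := x) (s := (24 * k + 90) * x + s + 26);
      [left; reflexivity|exact Henv3| | |exact La|exact Lc| | | |lia|lia| |].
    { rewrite S3, S2 by lia. registers. reflexivity. }
    { rewrite S3, S2 by lia. registers. reflexivity. }
    { now rewrite S3 by lia. }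
    { trivial. }
    { rewrite S3, S2 by lia. registers. reflexivity. }
    { rewrite Nat.add_0_r. eapply live_same; [exact Hl| |lia].
      intros r Hr'. rewrite S3, S2 by lia. same. }
    intros rg4 mm4 t4 Henv4 S4 Hl4.
    eapply wp_arc with (x := x) (s := (24 * k + 90) * x + s + 2);
      [right; reflexivity|exact Henv4| | |exact Lc|exact La| | | |lia|lia| |].
    { rewrite S4, S3, S2 by lia. registers. reflexivity. }
    { rewrite S4, S3, S2 by lia. registers. reflexivity. }
    { now rewrite S4 by lia. }
    { now rewrite S4, S3 by lia. }
    { rewrite S4, S3, S2 by lia. registers. reflexivity. }
    { eapply live_same; [exact Hl4|same|lia]. }
    intros rg5 mm5 t5 Henv5 S5 Hl5.
    split; [split; [lia|split; [trivial|split]]|].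
    + rewrite S5, S4, S3, S2 by lia. registers. reflexivity.
    + eapply live_same; [exact Hl5|same|lia].
    + rewrite S5, S4, S3, S2 by lia. registers. reflexivity.
  - clear Hx Henv Hr Hl.
    intros rg1 mm1 t1 (Hx & Henv & H9 & Hl) H10. apply HP; trivial.
    eapply live_same; [exact Hl|same|lia].
Qed.

Lemma wp_query ops outs s (P : assertion) rg mm t :
  live (Query :: ops) outs s rg mm t ->
  (forall rg' mm' t' a outs', outs = a :: outs' -> framed base rg mm rg' mm' ->
     rg' (dreg 0) = a -> a < 2 ^ v -> live ops outs' s rg' mm' t' ->
     P rg' mm' t') ->
  wp w (Sim (on_query D)) P rg mm t.
Proof.
  intros (st & T & Hs & (H4 & H7 & HR & HM) & Ht) HP.
  inversion Hs as [| |? T1 st' ? ? T2 Hh Hs']; subst. clear Hs.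
  eapply wp_sim with (B := B) (base := base); eauto.
  - repeat split; trivial.
    + simpl. destruct r; now apply HR.
    + simpl. destruct r; now apply HR.
    + now apply HM.
    + now apply HM.
  - intros rg' mm' t' Ht' Hsim F.
    pose proof Hsim as (_ & _ & HR' & _).
    destruct (HR' 0) as [R1 R2]; [lia|].
    eapply HP; [reflexivity|trivial|trivial|trivial|].
    exists st', T2. split; [trivial|split; [trivial|lia]].
Qed.

(** The invariant equates a fixed proposition with the verdict so far or a hit among the answers to
    come. Register 9 stays at most 1, which makes the bitwise [Or] a disjunction. *)
Lemma phase_loop outs s x rg mm t (P : assertion) :
  x <= n -> env rg mm -> rg 10 = x -> rg 9 <= 1 ->
  live (phase_ops n x) outs (40 * x + s + 1) rg mm t ->
  (forall rg' mm' t', env rg' mm' -> rg' 9 <= 1 ->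
     (rg' 9 <> 0 <-> rg 9 <> 0 \/ hits n k E x outs) ->
     live [] [] s rg' mm' t' -> P rg' mm' t') ->
  wp w (While 10 (phase_body D k)) P rg mm t.
Proof.
  intros Hx Henv Hr Hle Hl HP. pose proof (pow2_pos v) as Hpos.
  remember (rg 9 <> 0 \/ hits n k E x outs) as goal eqn:Egoal.
  apply wp_while with (x := x) (Inv := fun x rg' mm' t' =>
    x <= n /\ env rg' mm' /\ rg' 9 <= 1 /\
    exists outs', (rg' 9 <> 0 \/ hits n k E x outs' <-> goal) /\
    live (phase_ops n x) outs' (40 * x + s + 1) rg' mm' t').
  - clear x Hx Henv Hr Hle Hl HP Egoal.
    intros x rg1 mm1 t1 (Hx & Henv & H9 & outs1 & Hg & Hl) H10.
    unfold_env. cbn [phase_ops] in Hl. remember (rg1 9) as y eqn:Ey.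
    symmetry in Ey.
    unfold phase_body, decrement. apply wp_seq.
    step 1. apply wp_bin with (v := x); [evaluate|].
    step 3. step (3 * n). step (3 * n + x).
    apply wp_seq. insertion _ _ (40 * x + s + 33) Hl.
    intros rg2 mm2 t2 F Hl. track F Henv.
    tracking F 9 y. tracking F 10 x. tracking F 24 1.
    clear F Ey E0 E1 E2 E3 E5 E6 H10. unfold_env.
    step (n + x). step 4. step (4 * n). step (4 * n + 1). step (4 * n + 1 + x).
    apply wp_seq. insertion _ _ (40 * x + s + 20) Hl.
    intros rg3 mm3 t3 F Hl. track F Henv.
    tracking F 9 y. tracking F 10 x.
    clear F E0 E1 E2 E3 E5 E6.
    apply wp_seq. eapply wp_query; [exact Hl|].
    clear Hl. intros rg4 mm4 t4 a outs2 -> F Ha La Hl. track F Henv.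
    tracking F 9 y. tracking F 10 x. unfold_env. clear F.
    cbn [hits] in Hg. unfold dreg in Ha. cbn [Nat.add] in Ha.
    step (k + 2). step (k + 2 + x). step (2 * x + k + 2).
    step (if a =? 2 * x + k + 2 then 1 else 0).
    step (if a <? order n E then 1 else 0).
    step (if (a =? 2 * x + k + 2) && (a <? order n E) then 1 else 0).
    { destruct (a =? 2 * x + k + 2), (a <? order n E); evaluate. }
    apply wp_bin with (v := if negb (y =? 0)
      || ((a =? 2 * x + k + 2) && (a <? order n E)) then 1 else 0).
    { registers. apply ev_or; [|lia|].
      - destruct y as [|[|]]; [| |lia]; simpl negb; cbn [orb];
          destruct ((a =? 2 * x + k + 2) && (a <? order n E)); reflexivity.
      - destruct ((a =? 2 * x + k + 2) && (a <? order n E)); lia. }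
    split; [split; [lia|split; [eapply env_same; [exact Henv|same]|split]]|].
    + registers. destruct (_ || _); lia.
    + exists outs2. split; [|eapply live_same; [exact Hl|same|lia]].
      registers. rewrite <- Hg.
      destruct (Nat.eqb_spec y 0), (Nat.eqb_spec a (2 * x + k + 2)),
        (Nat.ltb_spec a (order n E)); cbn [negb andb orb]; intuition lia.
    + registers. reflexivity.
  - clear Hx Henv Hr Hl Hle.
    intros rg1 mm1 t1 (Hx & Henv & H9 & outs' & Hg & Hl) H10.
    assert (Ho : outs' = []).
    { destruct Hl as (st & T & Hs & _). now inversion Hs. }
    subst outs'. apply HP; trivial.
    + rewrite <- Hg. simpl. tauto.
    + eapply live_same; [exact Hl|same|lia].
  - repeat split; trivial; try apply Henv. exists outs. split; trivial.
    rewrite Egoal. tauto.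
  - trivial.
Qed.

Lemma wp_clear b rg mm t (P : assertion) :
  (forall rg', (forall r, r < 32 -> rg' r = rg r) ->
     (forall r, r < b -> rg' (dreg r) = 0) -> P rg' mm (t + b)) ->
  wp w (clear_cmd b) P rg mm t.
Proof.
  (* The recursion clears the highest register first, so the induction must know that registers from
     [b] up to [c] are left alone. *)
  assert (Hgen : forall b rg t (P : assertion) c,
    (forall rg', (forall r, r < 32 -> rg' r = rg r) ->
       (forall r, b <= r < c -> rg' (dreg r) = rg (dreg r)) ->
       (forall r, r < b -> rg' (dreg r) = 0) -> P rg' mm (t + b)) ->
    wp w (clear_cmd b) P rg mm t).
  { clear b rg t P. induction b as [|b IH]; intros rg t P c HP.
    - apply wp_skip. specialize (HP rg). rewrite Nat.add_0_r in HP.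
      apply HP; trivial. lia.
    - apply wp_seq, wp_cst with (v := 0).
      { apply Nat.mod_small. apply pow2_pos. }
      apply IH with (c := S b + c). intros rg' H1 H2 H3.
      rewrite Nat.add_succ_comm. apply HP.
      + intros r Hr. rewrite H1 by trivial. apply upd_other. unfold dreg. lia.
      + intros r Hr. rewrite H2 by lia. apply upd_other. unfold dreg. lia.
      + intros r Hr. destruct (Nat.eq_dec r b) as [->|].
        * rewrite H2 by lia. apply upd_same.
        * apply H3. lia. }
  intros HP. apply Hgen with (c := 0). auto.
Qed.

Lemma wp_trial T0 st0 T outs rg mm t (P : assertion) :
  2 <= k ->
  halts_in v (preprocess D)
    (call blank [order n E; 2 * m + 4 * n; 3 * n; 4 * n + 1]) T0 st0 ->
  serves v D st0 (layered_ops h n k E col) outs T ->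
  correct_answers g (order n E) (3 * n) (4 * n + 1) []
    (layered_ops h n k E col) outs ->
  (forall a, 2 ^ v <= a -> input a = 0) ->
  rg 0 = n -> rg 1 = m -> rg 2 = 2 * m + 4 * n -> rg 3 = order n E ->
  rg 4 = 2 ^ v -> rg 5 = Q -> rg 6 = S Z -> rg 9 <= 1 ->
  (forall a, a < base + 2 ^ v -> mm a = input a) ->
  t + 2 * (T0 + T) + (B + 24 * k * m + 90 * m + 60 * n + 30) <= budget ->
  (forall rg' mm' t', env rg' mm' -> rg' 4 = 2 ^ v -> rg' 9 <= 1 ->
     (rg' 9 <> 0 <-> rg 9 <> 0 \/ coloured_cycle h k E col) ->
     t' <= budget -> P rg' mm' t') ->
  wp w (trial_cmd D B k h) P rg mm t.
Proof.
  intros Hk Hpre Hserve Hcorr Hzero R0 R1 R2 R3 R4 R5 R6 R9 HM Hbud HP.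
  pose proof (pow2_pos v) as Hpos.
  assert (Hord : order n E < 2 ^ v) by (unfold order, m in *; lia).
  unfold trial_cmd, decrement. apply wp_seq.
  assert (HZ : S Z < 2 ^ w).
  { assert (S Z * 1 <= base) by (apply Nat.mul_le_mono_l; lia). lia. }
  step 1. apply wp_bin with (v := Z); [evaluate|].
  step (S Z). step base.
  apply wp_seq, wp_clear. intros rg1 S1 C1.
  assert (D0 : rg1 0 = n) by (rewrite S1 by lia; registers; trivial).
  assert (D1 : rg1 1 = m) by (rewrite S1 by lia; registers; trivial).
  assert (D2 : rg1 2 = 2 * m + 4 * n) by (rewrite S1 by lia; registers; trivial).
  assert (D3 : rg1 3 = order n E) by (rewrite S1 by lia; registers; trivial).
  assert (D4 : rg1 4 = 2 ^ v) by (rewrite S1 by lia; registers; trivial).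
  assert (D5 : rg1 5 = Q) by (rewrite S1 by lia; registers; trivial).
  assert (D6 : rg1 6 = Z) by (rewrite S1 by lia; registers; trivial).
  assert (D7 : rg1 7 = base) by (rewrite S1 by lia; registers; trivial).
  assert (D9 : rg1 9 = rg 9) by (rewrite S1 by lia; registers; trivial).
  assert (D24 : rg1 24 = 1) by (rewrite S1 by lia; registers; trivial).
  clear S1.
  step (order n E). step (2 * m + 4 * n). step 3. step (3 * n).
  step 4. step (4 * n). step (4 * n + 1).
  apply wp_seq. eapply wp_sim with (B := B) (base := base);
    [exact Hvw|exact Hbase|exact HDp|exact Hpre|reflexivity| |].
  { split; [registers; trivial|]. split; [registers; trivial|]. split.
    - intros r Hr.
      destruct r as [|[|[|[|r]]]]; registers; cbn [call reg nth];
        try (split; [reflexivity|lia]).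
      split; [etransitivity; [exact (C1 _ Hr)|]|]; now destruct r.
    (* The block is still as in the initial memory, and it lies beyond the input, hence is zero. *)
    - intros a Ha. cbn [call blank mem]. split; [|lia].
      rewrite HM by lia. apply Hzero. unfold base. simpl. lia. }
  intros rg2 mm2 t2 Ht2 Hsim F.
  assert (Henv : env rg2 mm2).
  { eapply env_framed; [|exact F].
    repeat split; registers; trivial. intros a Ha. apply HM. lia. }
  tracking F 9 (rg 9). clear F.
  assert (Hl : live (path_ops n n ++ arc_ops h n k E col m ++ phase_ops n n)
    outs (20 * n + (1 + ((24 * k + 90) * m + (1 + (40 * n + 1 + 1)) + 1)) + 2)
    rg2 mm2 t2).
  { exists st0, T. split; [exact Hserve|]. split; [exact Hsim|]. lia. }
  clear Hsim Ht2 Hbud. unfold_env.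
  step n. apply wp_seq.
  eapply path_loop with (x := n)
    (s := 1 + ((24 * k + 90) * m + (1 + (40 * n + 1 + 1)) + 1));
    [lia|eapply env_same; [exact Henv|same]|registers; trivial
    |eapply live_same; [exact Hl|same|lia]|].
  clear Hl Henv E0 E1 E2 E3 E5 E6.
  intros rg3 mm3 t3 Henv H9 Hl. rewrite upd_other in H9 by lia. unfold_env.
  step m. apply wp_seq.
  eapply edge_loop with (x := m) (s := 1 + (40 * n + 1 + 1));
    [lia|eapply env_same; [exact Henv|same]|registers; trivial
    |eapply live_same; [exact Hl|same|lia]|].
  clear Hl Henv E0 E1 E2 E3 E5 E6.
  intros rg4 mm4 t4 Henv H9' Hl. rewrite upd_other in H9' by lia. unfold_env.
  step n.
  eapply phase_loop with (x := n) (s := 0);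
    [lia|eapply env_same; [exact Henv|same]|registers; trivial
    |registers; lia|eapply live_same; [exact Hl|same|lia]|].
  clear Hl Henv E0 E1 E2 E3 E5 E6.
  intros rg5 mm5 t5 Henv H9'' Hiff Hl.
  rewrite upd_other in Hiff by lia.
  rewrite (hits_spec col HE Hk Hcorr) in Hiff.
  destruct Hl as (st & T' & _ & (H4 & _) & Ht).
  apply HP; trivial; [|lia].
  rewrite Hiff, H9', H9, H. tauto.
Qed.

End Trial.

(** * Computing the parameters and looping over the trials *)

Fixpoint power_cmd (j r rb : nat) : cmd :=
  match j with 0 => Skip | S j => Bin Mul r r rb ;; power_cmd j r rb end.

(** Doubles register 4 as long as the result does not exceed register 2 and leaves it unchanged
    afterwards. A linear number of rounds is affordable, so no early exit is needed. *)
Definition log_body : cmd :=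
  decrement 10 ;;
  Bin Add 18 4 4 ;; Bin Lt 19 2 18 ;; Bin Sub 19 24 19 ;; Bin Mul 19 19 4 ;;
  Bin Add 4 4 19.

Definition root_body (L : nat) : cmd :=
  decrement 10 ;;
  Cst 18 1 ;; power_cmd L 18 5 ;; Bin Lt 19 1 18 ;; Bin Sub 19 24 19 ;;
  Bin Add 5 5 19.

Definition main_cmd (D : data_structure) (B c k : nat) (h : graph_kind)
    (L A : nat) : cmd :=
  Cst 18 2 ;; Bin Mul 2 18 1 ;; Cst 18 4 ;; Bin Mul 18 18 0 ;; Bin Add 2 2 18 ;;
  Cst 18 5 ;; Bin Mul 3 18 0 ;; Cst 18 3 ;; Bin Add 3 3 18 ;;
  Bin Add 3 3 1 ;; Bin Add 3 3 1 ;;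
  Cst 4 1 ;; Bin Or 10 2 2 ;; While 10 log_body ;;
  Cst 18 4 ;; Bin Mul 18 18 4 ;; Cst 4 1 ;; power_cmd c 4 18 ;;
  Cst 5 1 ;; Bin Or 10 1 1 ;; While 10 (root_body L) ;;
  Cst 18 A ;; Bin Mul 5 18 5 ;;
  Cst 6 1 ;; power_cmd (S k) 6 5 ;;
  Cst 9 0 ;;
  While 6 (trial_cmd D B k h) ;;
  Bin Or 0 9 9.

Section Init.

Variable w : nat.

Lemma wp_power j r rb b (P : assertion) mm : r <> rb -> 1 <= b ->
  forall a rg t, rg r = a -> rg rb = b -> a * b ^ j < 2 ^ w ->
  (forall rg', (forall s, s <> r -> rg' s = rg s) -> rg' r = a * b ^ j ->
     P rg' mm (t + j)) ->
  wp w (power_cmd j r rb) P rg mm t.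
Proof.
  intros Hr Hb. induction j as [|j IH]; intros a rg t Ha Hrb Hw HP.
  - apply wp_skip. specialize (HP rg). rewrite Nat.add_0_r in HP.
    apply HP; trivial. simpl. lia.
  - apply wp_seq, wp_bin with (v := a * b).
    { rewrite Ha, Hrb. apply ev_mul; trivial. simpl in Hw.
      assert (1 <= b ^ j) by (apply Nat.neq_0_lt_0, Nat.pow_nonzero; lia). nia. }
    apply IH with (a := a * b).
    + apply upd_same.
    + rewrite upd_other; auto.
    + now rewrite <- Nat.mul_assoc.
    + intros rg' S1 R1. rewrite Nat.add_succ_comm. apply HP.
      * intros s Hs. rewrite S1 by trivial. now apply upd_other.
      * rewrite R1. simpl. ring.
Qed.

Lemma wp_log M rg mm t (P : assertion) :
  1 <= M -> 2 * M + 2 < 2 ^ w -> rg 2 = M -> rg 4 = 1 -> rg 10 = M ->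
  (forall rg' t', (forall r, r <= 9 -> r <> 4 -> rg' r = rg r) ->
     rg' 4 = 2 ^ Nat.log2 M -> t' <= t + 10 * M + 1 -> P rg' mm t') ->
  wp w (While 10 log_body) P rg mm t.
Proof.
  intros HM Hw R2 R4 R10 HP.
  apply wp_while with (x := M) (Inv := fun x rg' mm' t' =>
    mm' = mm /\ (forall r, r <= 9 -> r <> 4 -> rg' r = rg r) /\
    x <= M /\ t' + 10 * x <= t + 10 * M /\
    exists j, rg' 4 = 2 ^ j /\ 2 ^ j <= M /\ (j = M - x \/ M < 2 * 2 ^ j)).
  - intros x rg1 mm1 t1 (-> & Hs & Hx & Ht & j & H4 & Hj & Hor) H10.
    assert (H2 : rg1 2 = M) by (rewrite Hs; lia || trivial).
    pose proof (pow2_pos j).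
    unfold log_body, decrement. apply wp_seq. step 1.
    apply wp_bin with (v := x); [evaluate|].
    step (2 * 2 ^ j). step (if M <? 2 * 2 ^ j then 1 else 0).
    step (if M <? 2 * 2 ^ j then 0 else 1).
    { destruct (M <? 2 * 2 ^ j); evaluate. }
    step (if M <? 2 * 2 ^ j then 0 else 2 ^ j).
    { destruct (M <? 2 * 2 ^ j); evaluate. }
    apply wp_bin with (v := if M <? 2 * 2 ^ j then 2 ^ j else 2 ^ S j).
    { cbn [Nat.pow]. destruct (Nat.ltb_spec M (2 * 2 ^ j)); evaluate. }
    split; [|registers; reflexivity].
    split; [trivial|]. split.
    { intros r Hr Hr4. rewrite !upd_other by lia. auto. }
    split; [lia|]. split; [lia|]. registers.
    destruct (Nat.ltb_spec M (2 * 2 ^ j)).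
    + exists j. repeat split; trivial. now right.
    + exists (S j). cbn [Nat.pow]. repeat split; trivial; lia.
  - intros rg1 mm1 t1 (-> & Hs & Hx & Ht & j & H4 & Hj & Hor) H10.
    apply HP; trivial; [|lia].
    rewrite H4. f_equal. symmetry. apply Nat.log2_unique; [lia|].
    split; trivial. cbn [Nat.pow]. destruct Hor as [->|]; [|trivial].
    (* If the exponent grew in every round it is now [M], and M < 2^M. *)
    rewrite Nat.sub_0_r. pose proof (Nat.pow_gt_lin_r 2 M). lia.
  - split; [trivial|]. split; [trivial|]. split; [lia|]. split; [lia|].
    exists 0. simpl. lia.
  - trivial.
Qed.

(** Linear search for the least X with m < X^L. That inequality is needed to separate the vertices;
    minimality, in the form (X - 1)^L <= m, bounds the number of trials. *)
Lemma wp_root L m rg mm t (P : assertion) :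
  1 <= L -> 1 <= m -> (m + 1) ^ L < 2 ^ w ->
  rg 1 = m -> rg 5 = 1 -> rg 10 = m ->
  (forall rg' t' X, (forall r, r <= 9 -> r <> 5 -> rg' r = rg r) ->
     rg' 5 = X -> 2 <= X -> m < X ^ L -> (X - 1) ^ L <= m ->
     t' <= t + (10 + L) * m + 1 -> P rg' mm t') ->
  wp w (While 10 (root_body L)) P rg mm t.
Proof.
  intros HL Hm Hw R1 R5 R10 HP.
  assert (Hlin : forall X, 1 <= X -> X <= X ^ L).
  { intros X HX. destruct L as [|l]; [lia|]. simpl.
    assert (1 <= X ^ l) by (apply Nat.neq_0_lt_0, Nat.pow_nonzero; lia). nia. }
  pose proof (Hlin (m + 1)) as Hm1.
  apply wp_while with (x := m) (Inv := fun x rg' mm' t' =>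
    mm' = mm /\ (forall r, r <= 9 -> r <> 5 -> rg' r = rg r) /\
    x <= m /\ t' + (10 + L) * x <= t + (10 + L) * m /\
    1 <= rg' 5 <= m + 1 /\ (rg' 5 - 1) ^ L <= m /\
    (rg' 5 = 1 + (m - x) \/ m < rg' 5 ^ L)).
  - intros x rg1 mm1 t1 (-> & Hs & Hx & Ht & H5 & Hlo & Hor) H10.
    assert (H1 : rg1 1 = m) by (rewrite Hs; lia || trivial).
    remember (rg1 5) as X eqn:EX. symmetry in EX.
    unfold root_body, decrement. apply wp_seq. step 1.
    apply wp_bin with (v := x); [evaluate|].
    step 1.
    assert (HXw : X ^ L <= (m + 1) ^ L) by (apply Nat.pow_le_mono_l; lia).
    apply wp_seq. apply wp_power with (b := X) (a := 1);
      [lia|lia|registers; trivial|registers; trivial|lia|].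
    intros rg2 S2 P2. rewrite Nat.mul_1_l in P2.
    assert (H1' : rg2 1 = m) by (rewrite S2 by lia; registers; trivial).
    assert (H5' : rg2 5 = X) by (rewrite S2 by lia; registers; trivial).
    assert (H10' : rg2 10 = x) by (rewrite S2 by lia; registers; trivial).
    assert (H24' : rg2 24 = 1) by (rewrite S2 by lia; registers; trivial).
    step (if m <? X ^ L then 1 else 0).
    step (if m <? X ^ L then 0 else 1).
    { destruct (m <? X ^ L); evaluate. }
    apply wp_bin with (v := if m <? X ^ L then X else S X).
    { destruct (Nat.ltb_spec m (X ^ L)); evaluate. }
    split; [|registers; reflexivity].
    split; [trivial|]. split.
    { intros r Hr Hr5. rewrite !upd_other by lia. rewrite S2 by lia.
      rewrite !upd_other by lia. auto. }
    split; [lia|]. split; [lia|]. registers.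
    destruct (Nat.ltb_spec m (X ^ L)).
    + repeat split; trivial; lia.
    + replace (S X - 1) with X by lia.
      destruct Hor as [Hor|]; [|lia]. repeat split; trivial; lia.
  - intros rg1 mm1 t1 (-> & Hs & Hx & Ht & H5 & Hlo & Hor) H10.
    assert (Hgt : m < rg1 5 ^ L).
    { destruct Hor as [->|]; [|trivial]. pose proof (Hlin (1 + (m - 0))). lia. }
    apply HP with (X := rg1 5); trivial; try lia.
    destruct (Nat.eq_dec (rg1 5) 1) as [e|]; [|lia].
    rewrite e, Nat.pow_1_l in Hgt. lia.
  - split; [trivial|]. split; [trivial|]. split; [lia|]. split; [lia|].
    rewrite R5. split; [lia|]. split; [|lia].
    rewrite Nat.sub_diag, Nat.pow_0_l by lia. lia.
  - trivial.
Qed.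

End Init.

Definition edge_memory (E : list edge) (a : nat) : nat :=
  nth a (flat_map (fun e => [fst e; snd e]) E) 0.

Lemma edge_memory_spec E : forall e u u', e < length E ->
  nth e E (0, 0) = (u, u') ->
  edge_memory E (2 * e) = u /\ edge_memory E (2 * e + 1) = u'.
Proof.
  unfold edge_memory. induction E as [|[a b] E IH]; intros e u u' He Hn;
    [simpl in He; lia|].
  destruct e as [|e].
  - simpl in Hn. injection Hn as -> ->. now split.
  - replace (2 * S e + 1) with (S (S (2 * e + 1))) by lia.
    replace (2 * S e) with (S (S (2 * e))) by lia.
    cbn [flat_map app fst snd nth]. apply IH; trivial. simpl in He. lia.
Qed.

Lemma edge_memory_outside E a : 2 * length E <= a -> edge_memory E a = 0.
Proof.
  intros H. apply nth_overflow. etransitivity; [|exact H]. clear H.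
  induction E as [|e E IH]; cbn [flat_map app length]; lia.
Qed.

(** * The whole algorithm on a fixed input *)

Section Main.

Variables (w v : nat) (D : data_structure) (B c : nat) (h g : graph_kind).
Variables (n k L A : nat) (E : list edge) (TD : nat).

Let m := length E.

Definition trial_cost : nat := TD + B + 24 * k * m + 90 * m + 60 * n + 32.

Hypothesis HB : 4 <= B.
Hypothesis HDp : Forall (regs_below B) (preprocess D).
Hypothesis HDi : Forall (regs_below B) (on_insert D).
Hypothesis HDq : Forall (regs_below B) (on_query D).
Hypothesis HE : simple_graph h n E.
Hypothesis Hk : 2 <= k.
Hypothesis Hm : 1 <= m.
Hypothesis Hn : 1 <= n <= 2 * m.
Hypothesis Hc : 1 <= c.
Hypothesis HL : 1 <= L.
Hypothesis Hv : v = word_size c (2 * m + 4 * n).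
Hypothesis Hsize : 2 * (2 * m + 4 * n) < 2 ^ v.
Hypothesis Hkw : k + 2 + 2 ^ v < 2 ^ w.
Hypothesis HA : A < 2 ^ w.
Hypothesis HwL : (m + 1) ^ L < 2 ^ w.
Hypothesis HwQ : ((A * (m + 1)) ^ S k + 1) * 2 ^ v < 2 ^ w.
Hypothesis Hserve : exists T0 st0,
  halts_in v (preprocess D)
    (call blank [order n E; 2 * m + 4 * n; 3 * n; 4 * n + 1]) T0 st0 /\
  forall col, exists outs T,
    serves v D st0 (layered_ops h n k E col) outs T /\
    correct_answers g (order n E) (3 * n) (4 * n + 1) []
      (layered_ops h n k E col) outs /\
    2 * (T0 + T) <= TD.

(** Trial numbers decrease. A finished trial may have spoiled its own block and everything above,
    while the memory below still equals the initial one, which includes the input and the block of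
    the next trial. *)
Lemma wp_trials Q N rg mm t (P : assertion) :
  (N + 1) * 2 ^ v < 2 ^ w -> Q < 2 ^ w ->
  rg 0 = n -> rg 1 = m -> rg 2 = 2 * m + 4 * n -> rg 3 = order n E ->
  rg 4 = 2 ^ v -> rg 5 = Q -> rg 6 = N -> rg 9 = 0 ->
  (forall a, mm a = edge_memory E a) ->
  (forall rg' mm' t', rg' 9 <= 1 ->
     (rg' 9 <> 0 <-> exists Z, Z < N /\ coloured_cycle h k E (colour k Q Z)) ->
     t' <= t + N * trial_cost + 1 -> P rg' mm' t') ->
  wp w (While 6 (trial_cmd D B k h)) P rg mm t.
Proof.
  intros HN HQ R0 R1 R2 R3 R4 R5 R6 R9 HM HP.
  destruct Hserve as (T0 & st0 & Hpre & Hs). clear Hserve.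
  apply wp_while with (x := N) (Inv := fun Z rg' mm' t' =>
    rg' 0 = n /\ rg' 1 = m /\ rg' 2 = 2 * m + 4 * n /\ rg' 3 = order n E /\
    rg' 4 = 2 ^ v /\ rg' 5 = Q /\ rg' 9 <= 1 /\ Z <= N /\
    (rg' 9 <> 0 <->
       exists Z', Z <= Z' < N /\ coloured_cycle h k E (colour k Q Z')) /\
    (forall a, a < S Z * 2 ^ v -> mm' a = edge_memory E a) /\
    t' + Z * trial_cost <= t + N * trial_cost).
  - intros Z rg1 mm1 t1
      (H0 & H1 & H2 & H3 & H4 & H5 & H9 & HZ & Hiff & Hmem & Ht) H6.
    destruct (Hs (colour k Q Z)) as (outs & T & Hsv & Hcor & HT).
    assert (Hb : (S Z + 1) * 2 ^ v <= (N + 1) * 2 ^ v)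
      by (apply Nat.mul_le_mono_r; lia).
    assert (Hvw : v <= w).
    { apply (Nat.pow_le_mono_r_iff 2); lia. }
    eapply wp_trial with (Q := Q) (Z := Z) (input := edge_memory E)
      (budget := t1 + trial_cost - 1);
      [exact Hvw|lia|exact Hsize|lia|exact Hkw|exact HQ|exact HB|exact HDp
      |exact HDi|exact HDq|exact HE|exact (@edge_memory_spec E)|exact Hk
      |exact Hpre|exact Hsv|exact Hcor| |exact H0|exact H1|exact H2|exact H3
      |exact H4|exact H5|exact H6|exact H9| | |].
    + intros a Ha. apply edge_memory_outside. fold m. lia.
    + intros a Ha. apply Hmem. lia.
    + fold m. unfold trial_cost. lia.
    + intros rg2 mm2 t2 (G0 & G1 & G2 & G3 & G5 & G6 & GM) G4 G9 Giff Gt.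
      split; [|exact G6].
      do 7 (split; [trivial|]). split; [lia|]. split; [|split].
      * rewrite Giff, Hiff. split.
        -- intros [(Z' & HZ' & Hcy)|Hcy]; [exists Z'|exists Z];
             split; trivial; lia.
        -- intros (Z' & HZ' & Hcy). destruct (Nat.eq_dec Z' Z) as [->|];
             [now right|]. left. exists Z'. split; [lia|trivial].
      * exact GM.
      * simpl in Ht. unfold trial_cost in *. lia.
  - intros rg1 mm1 t1
      (H0 & H1 & H2 & H3 & H4 & H5 & H9 & HZ & Hiff & Hmem & Ht) H6.
    apply HP; trivial; [|lia]. rewrite Hiff. split; intros (Z & HZ' & Hcy);
      exists Z; split; trivial; lia.
  - do 6 (split; [trivial|]). split; [lia|]. split; [lia|].
    split; [|split; [auto|lia]].
    split; [lia|]. intros (Z & HZ & _). lia.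
  - trivial.
Qed.

Lemma wp_main : A = S L * (k * k) * fact (S L * (k * k)) + 2 ->
  min_cycle_length h <= k ->
  wp w (main_cmd D B c k h L A)
    (fun rg mm t =>
       (rg 0 <> 0 <-> has_cycle h k E) /\
       exists X, 2 <= X /\ (X - 1) ^ L <= m /\
         t <= (A * X) ^ S k * trial_cost + (200 + L + c + k) * m)
    (reg (cycle_input n m E)) (mem (cycle_input n m E)) 0.
Proof.
  intros EA Hmin. change (mem (cycle_input n m E)) with (edge_memory E).
  set (rg0 := reg (cycle_input n m E)).
  assert (R0 : rg0 0 = n) by reflexivity. assert (R1 : rg0 1 = m) by reflexivity.
  clearbody rg0. pose proof (pow2_pos v) as Hpos.
  unfold main_cmd.
  step 2. step (2 * m). step 4. step (4 * n). step (2 * m + 4 * n).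
  step 5. step (5 * n). step 3. step (5 * n + 3). step (5 * n + 3 + m).
  step (order n E); [unfold order, m in *; evaluate|].
  step 1. step (2 * m + 4 * n).
  apply wp_seq. apply wp_log with (M := 2 * m + 4 * n);
    [lia|lia|registers; trivial|registers; trivial|registers; trivial|].
  intros rg1 t1 S1 H4 Ht1.
  assert (G0 : rg1 0 = n) by (rewrite S1 by lia; registers; trivial).
  assert (G1 : rg1 1 = m) by (rewrite S1 by lia; registers; trivial).
  assert (G2 : rg1 2 = 2 * m + 4 * n) by (rewrite S1 by lia; registers; trivial).
  assert (G3 : rg1 3 = order n E) by (rewrite S1 by lia; registers; trivial).
  clear S1 R0 R1. set (p := 2 ^ Nat.log2 (2 * m + 4 * n)) in *.
  (* The simulated word size c (log M + 2) turns into a power with constant exponent [c], which the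
     machine can compute. *)
  assert (Ev : (4 * p) ^ c = 2 ^ v).
  { rewrite Hv. unfold word_size, p. rewrite (Nat.mul_comm c), Nat.pow_mul_r.
    f_equal. rewrite Nat.pow_add_r. simpl. lia. }
  assert (Hp : 1 <= p <= 2 * m + 4 * n).
  { split; [apply pow2_pos|]. apply Nat.log2_spec. lia. }
  assert (H4p : 4 * p <= 2 ^ v).
  { rewrite <- Ev, <- (Nat.pow_1_r (4 * p)) at 1.
    apply Nat.pow_le_mono_r; lia. }
  step 4. step (4 * p). step 1.
  apply wp_seq. apply wp_power with (b := 4 * p) (a := 1);
    [lia|lia|registers; trivial|registers; trivial|rewrite Ev; lia|].
  intros rg2 S2 P4. rewrite Nat.mul_1_l, Ev in P4.
  assert (F0 : rg2 0 = n) by (rewrite S2 by lia; registers; trivial).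
  assert (F1 : rg2 1 = m) by (rewrite S2 by lia; registers; trivial).
  assert (F2 : rg2 2 = 2 * m + 4 * n) by (rewrite S2 by lia; registers; trivial).
  assert (F3 : rg2 3 = order n E) by (rewrite S2 by lia; registers; trivial).
  clear S2 G0 G1 G2 G3 H4.
  step 1. step m.
  apply wp_seq. apply wp_root with (m := m);
    [lia|lia|lia|registers; trivial|registers; trivial|registers; trivial|].
  intros rg3 t3 X S3 H5 HX HXL HXm Ht3.
  assert (G0 : rg3 0 = n) by (rewrite S3 by lia; registers; trivial).
  assert (G1 : rg3 1 = m) by (rewrite S3 by lia; registers; trivial).
  assert (G2 : rg3 2 = 2 * m + 4 * n) by (rewrite S3 by lia; registers; trivial).
  assert (G3 : rg3 3 = order n E) by (rewrite S3 by lia; registers; trivial).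
  assert (G4 : rg3 4 = 2 ^ v) by (rewrite S3 by lia; registers; trivial).
  clear S3 F0 F1 F2 F3 P4.
  assert (HXle : X <= m + 1).
  { destruct L as [|l]; [lia|]. simpl in HXm.
    assert (1 <= (X - 1) ^ l) by (apply Nat.neq_0_lt_0, Nat.pow_nonzero; lia).
    nia. }
  set (Q := A * X).
  assert (HQ : 1 <= Q <= A * (m + 1)).
  { unfold Q. split; [nia|]. apply Nat.mul_le_mono_l. lia. }
  assert (HQk : Q ^ S k <= (A * (m + 1)) ^ S k)
    by (apply Nat.pow_le_mono_l; lia).
  assert (HN : (Q ^ S k + 1) * 2 ^ v < 2 ^ w).
  { eapply Nat.le_lt_trans; [|exact HwQ]. apply Nat.mul_le_mono_r. lia. }
  assert (HQN : Q <= Q ^ S k).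
  { simpl. assert (1 <= Q ^ k) by (apply Nat.neq_0_lt_0, Nat.pow_nonzero; lia).
    nia. }
  assert (HNw : Q ^ S k < 2 ^ w) by nia.
  step A. step Q. step 1.
  apply wp_seq. apply wp_power with (b := Q) (a := 1);
    [lia|lia|registers; trivial|registers; trivial|lia|].
  intros rg4 S4 P6. rewrite Nat.mul_1_l in P6.
  assert (F0 : rg4 0 = n) by (rewrite S4 by lia; registers; trivial).
  assert (F1 : rg4 1 = m) by (rewrite S4 by lia; registers; trivial).
  assert (F2 : rg4 2 = 2 * m + 4 * n) by (rewrite S4 by lia; registers; trivial).
  assert (F3 : rg4 3 = order n E) by (rewrite S4 by lia; registers; trivial).
  assert (F4 : rg4 4 = 2 ^ v) by (rewrite S4 by lia; registers; trivial).
  assert (F5 : rg4 5 = Q) by (rewrite S4 by lia; registers; trivial).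
  clear S4 G0 G1 G2 G3 G4 H5.
  step 0. apply wp_seq. apply wp_trials with (Q := Q) (N := Q ^ S k);
    [exact HN|lia|registers; trivial|registers; trivial|registers; trivial
    |registers; trivial|registers; trivial|registers; trivial
    |registers; trivial|registers; trivial|trivial|].
  intros rg5 mm5 t5 H9 Hiff Ht5.
  apply wp_bin with (v := rg5 9); [apply ev_move; lia|].
  split.
  - rewrite upd_same, Hiff. split.
    + intros (Z & _ & HZ). now apply coloured_cycle_sound in HZ.
    + intros Hcy. unfold Q. rewrite EA.
      apply has_cycle_coloured with (n := n) (m := m); trivial. lia.
  - exists X. repeat split; trivial. unfold Q in Ht5.
    pose proof (Nat.mul_le_mono_l 1 m c Hm).
    pose proof (Nat.mul_le_mono_l 1 m k Hm). lia.
Qed.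

End Main.

(** * Word sizes *)

Lemma pow_lt_word c m : 1 <= c -> (2 * m) ^ c < 2 ^ word_size c m.
Proof.
  intros Hc. unfold word_size. rewrite (Nat.mul_comm c), Nat.pow_mul_r.
  apply Nat.pow_lt_mono_l; [lia|]. destruct m as [|m]; [apply pow2_pos|].
  pose proof (Nat.log2_spec (S m)) as [_ H]; [lia|].
  replace (Nat.log2 (S m) + 2) with (S (S (Nat.log2 (S m)))) by lia.
  simpl in *. lia.
Qed.

Lemma word_size_value c m : 1 <= m -> 2 ^ word_size c m <= (4 * m) ^ c.
Proof.
  intros Hm. unfold word_size. rewrite (Nat.mul_comm c), Nat.pow_mul_r.
  apply Nat.pow_le_mono_l. pose proof (Nat.log2_spec m) as [H _]; [lia|].
  rewrite Nat.pow_add_r. simpl (2 ^ 2). lia.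
Qed.

Lemma pow_ge_1 N e : 1 <= N -> 1 <= N ^ e.
Proof. intros. apply Nat.neq_0_lt_0, Nat.pow_nonzero. lia. Qed.

Lemma add_le_mul M a b x y :
  2 <= M -> x <= a -> y <= b -> 1 <= x -> 1 <= y -> x + y <= M * a * b.
Proof.
  intros HM Hx Hy H1 H2.
  assert (a + b <= 2 * (a * b)) by nia.
  assert (2 * (a * b) <= M * (a * b)) by (apply Nat.mul_le_mono_r; lia). lia.
Qed.

Section WordBounds.

Variables (m n c k L A : nat).
Hypothesis Hm : 1 <= m.

(** Every number that occurs is at most (2 m)^e for a constant e, where a constant x is absorbed
    through x <= 2^x <= (2 m)^x. The summands cover these exponents. *)
Definition outer_word_constant : nat :=
  L + A + (A + 1) * S k + 6 * c + k + 10.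

Let w := word_size outer_word_constant m.

Lemma pow_lt_outer x e :
  e <= outer_word_constant -> x <= (2 * m) ^ e -> x < 2 ^ w.
Proof.
  intros He Hx. eapply Nat.le_lt_trans; [exact Hx|].
  eapply Nat.le_lt_trans; [apply Nat.pow_le_mono_r with (c := outer_word_constant)|];
    [lia|exact He|].
  apply pow_lt_word. unfold outer_word_constant. lia.
Qed.

Lemma le_pow_base x : x <= (2 * m) ^ x.
Proof.
  pose proof (Nat.pow_gt_lin_r 2 x).
  assert (2 ^ x <= (2 * m) ^ x) by (apply Nat.pow_le_mono_l; lia). lia.
Qed.

Lemma bound_A : A < 2 ^ w.
Proof.
  apply pow_lt_outer with (e := A); [unfold outer_word_constant; lia|].
  apply le_pow_base.
Qed.

Lemma bound_L : (m + 1) ^ L < 2 ^ w.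
Proof.
  apply pow_lt_outer with (e := L); [unfold outer_word_constant; lia|].
  apply Nat.pow_le_mono_l. lia.
Qed.

Hypothesis Hn : n <= 2 * m.
Hypothesis Hc : 1 <= c.

Let v := word_size c (2 * m + 4 * n).

(** The 6 comes from 4 (2 m + 4 n) <= 40 m <= 2 m 2^5 <= (2 m)^6. *)
Lemma inner_word_le : 2 ^ v <= (2 * m) ^ (6 * c).
Proof.
  eapply Nat.le_trans; [apply word_size_value; lia|].
  rewrite Nat.pow_mul_r. apply Nat.pow_le_mono_l.
  change ((2 * m) ^ 6) with (2 * m * (2 * m) ^ 5).
  assert (2 ^ 5 <= (2 * m) ^ 5) by (apply Nat.pow_le_mono_l; lia).
  simpl (2 ^ 5) in *. nia.
Qed.

Lemma bound_k : k + 2 + 2 ^ v < 2 ^ w.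
Proof.
  apply pow_lt_outer with (e := 1 + (k + 2) + 6 * c);
    [unfold outer_word_constant; lia|].
  pose proof inner_word_le as H1. pose proof (le_pow_base (k + 2)) as H2.
  rewrite (Nat.pow_add_r _ _ (6 * c)), (Nat.pow_add_r _ 1), Nat.pow_1_r.
  apply add_le_mul; trivial; [lia|lia|apply pow2_pos].
Qed.

Lemma bound_Q : ((A * (m + 1)) ^ S k + 1) * 2 ^ v < 2 ^ w.
Proof.
  apply pow_lt_outer with (e := 1 + (A + 1) * S k + 6 * c);
    [unfold outer_word_constant; lia|].
  rewrite !(Nat.pow_add_r _ _ (6 * c)).
  apply Nat.mul_le_mono; [|apply inner_word_le].
  rewrite Nat.pow_add_r, Nat.pow_1_r, Nat.pow_mul_r.
  assert (H : (A * (m + 1)) ^ S k <= ((2 * m) ^ (A + 1)) ^ S k).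
  { apply Nat.pow_le_mono_l. rewrite Nat.pow_add_r, Nat.pow_1_r.
    apply Nat.mul_le_mono; [apply le_pow_base|lia]. }
  assert (1 <= ((2 * m) ^ (A + 1)) ^ S k) by (apply pow_ge_1, pow_ge_1; lia).
  nia.
Qed.

Lemma bound_size : 2 * (2 * m + 4 * n) < 2 ^ v.
Proof.
  eapply Nat.le_lt_trans; [|apply pow_lt_word; exact Hc].
  rewrite <- (Nat.pow_1_r (2 * (2 * m + 4 * n))) at 1.
  apply Nat.pow_le_mono_r; lia.
Qed.

End WordBounds.

(** * Running times *)

Open Scope R_scope.

Lemma nat_upper (r : R) : 0 <= r -> exists N : nat, r <= INR N <= r + 1.
Proof.
  intros Hr. exists (Z.to_nat (up r)). destruct (archimed r) as [H1 H2].
  assert (0 <= up r)%Z by (apply le_IZR; simpl; lra).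
  rewrite INR_IZR_INZ, Z2Nat.id by trivial. lra.
Qed.

Lemma one_le_Rpower x a : 1 <= x -> 0 <= a -> 1 <= Rpower x a.
Proof. intros Hx Ha. rewrite <- (Rpower_O x) by lra. now apply Rle_Rpower. Qed.

Lemma le_Rpower x a : 1 <= x -> 1 <= a -> x <= Rpower x a.
Proof.
  intros Hx Ha. rewrite <- (Rpower_1 x) at 1 by lra. now apply Rle_Rpower.
Qed.

Lemma ln_monotone x y : 0 < x -> x <= y -> ln x <= ln y.
Proof.
  intros Hx [H| ->]; [left; now apply ln_increasing|apply Rle_refl].
Qed.

(** Taking logarithms, y is at most the L-th root of x, so its j-th power is at most x^(j/L). *)
Lemma pow_root_le (y x : R) (L j : nat) (d : R) :
  1 <= y -> 1 <= x -> (1 <= L)%nat -> y ^ L <= x -> INR j <= d * INR L ->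
  y ^ j <= Rpower x d.
Proof.
  intros Hy Hx HL Hle Hd.
  rewrite <- Rpower_pow by lra. unfold Rpower.
  assert (HL' : 0 < INR L) by (apply lt_0_INR; lia).
  assert (Hln : INR L * ln y <= ln x).
  { rewrite <- ln_pow by lra. apply ln_monotone; [apply pow_lt; lra|trivial]. }
  assert (0 <= ln y) by (rewrite <- ln_1; apply ln_monotone; lra).
  assert (0 <= ln x) by (rewrite <- ln_1; apply ln_monotone; lra).
  assert (0 <= INR j) by apply pos_INR.
  assert (0 <= d) by (apply Rmult_le_reg_r with (INR L); nra).
  assert (d * (INR L * ln y) <= d * ln x) by nra.
  assert (INR j * ln y <= d * INR L * ln y) by nra.
  destruct (Rle_lt_or_eq_dec (INR j * ln y) (d * ln x)) as [H5|H5]; [lra| |].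
  - left. now apply exp_increasing.
  - rewrite H5. apply Rle_refl.
Qed.

(** Preprocessing contributes one share of M^(2-e), and at most 2 M operations of M^(1-e) contribute
    two. The sign of [C] is unknown, hence the absolute value. *)
Lemma data_structure_time (C M len e eps T0 T : R) :
  1 <= M -> e <= eps -> 0 <= len <= 2 * M ->
  T0 <= C * Rpower M (2 - eps) -> T <= C * (len * Rpower M (1 - eps)) ->
  T0 + T <= 3 * Rabs C * Rpower M (2 - e).
Proof.
  intros HM He Hlen H0 H1.
  assert (HP : forall a, 0 < Rpower M a) by (intros; apply exp_pos).
  assert (H2 : Rpower M (2 - eps) <= Rpower M (2 - e))
    by (apply Rle_Rpower; lra).
  assert (H3 : Rpower M (1 - eps) <= Rpower M (1 - e))
    by (apply Rle_Rpower; lra).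
  assert (H4 : M * Rpower M (1 - e) = Rpower M (2 - e)).
  { rewrite <- (Rpower_1 M) at 1 by lra. rewrite <- Rpower_plus. f_equal. lra. }
  pose proof (Rle_abs C) as HC. pose proof (Rabs_pos C) as HC0.
  pose proof (HP (2 - eps)). pose proof (HP (1 - eps)).
  assert (T0 <= Rabs C * Rpower M (2 - e)).
  { eapply Rle_trans; [exact H0|]. eapply Rle_trans;
      [apply Rmult_le_compat_r; [lra|exact HC]|].
    apply Rmult_le_compat_l; lra. }
  assert (T <= Rabs C * (2 * Rpower M (2 - e))).
  { eapply Rle_trans; [exact H1|]. eapply Rle_trans;
      [apply Rmult_le_compat_r; [|exact HC]; apply Rmult_le_pos; lra|].
    apply Rmult_le_compat_l; [lra|]. rewrite <- H4.
    rewrite <- Rmult_assoc. apply Rmult_le_compat; lra. }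
  lra.
Qed.

(** The layered graph has at most 10 m edges, and 100 = 10^2 covers all exponents up to 2. *)
Lemma Rpower_scale (M x b : R) :
  0 < M <= 10 * x -> 0 < x -> 0 <= b <= 2 -> Rpower M b <= 100 * Rpower x b.
Proof.
  intros HM Hx Hb. eapply Rle_trans; [apply Rle_Rpower_l with (b := 10 * x); lra|].
  rewrite <- Rpower_mult_distr by lra.
  apply Rmult_le_compat_r; [left; apply exp_pos|].
  replace 100 with (Rpower 10 (INR 2)) by (rewrite Rpower_pow by lra; simpl; lra).
  apply Rle_Rpower; simpl; lra.
Qed.

Lemma total_time (k L A X TD K1 K2 m : nat) (e c0 : R) (T : nat) :
  (1 <= m)%nat -> (2 <= X)%nat -> (1 <= L)%nat -> ((X - 1) ^ L <= m)%nat ->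
  0 < e <= 1 -> INR (S k) <= e / 2 * INR L -> 0 <= c0 ->
  INR TD <= c0 * Rpower (INR m) (2 - e) ->
  (T <= (A * X) ^ S k * (TD + K1 * m) + K2 * m)%nat ->
  INR T <= ((INR (2 * A)) ^ S k * (c0 + INR K1) + INR K2)
             * Rpower (INR m) (2 - e / 2).
Proof.
  intros Hm HX HL HXL He Hk Hc0 HTD HT.
  assert (Hm1 : 1 <= INR m) by (change 1 with (INR 1); now apply le_INR).
  set (U := Rpower (INR m) (e / 2)). set (Y := Rpower (INR m) (2 - e)) in *.
  assert (HUY : Rpower (INR m) (2 - e / 2) = U * Y).
  { unfold U, Y. rewrite <- Rpower_plus. f_equal. lra. }
  rewrite HUY.
  assert (HU : 1 <= U) by (apply one_le_Rpower; lra).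
  assert (HY : INR m <= Y) by (apply le_Rpower; lra).
  assert (HXU : INR (X - 1) ^ S k <= U).
  { apply pow_root_le with (L := L); trivial.
    - change 1 with (INR 1). apply le_INR. lia.
    - rewrite <- pow_INR. now apply le_INR. }
  assert (HQ : INR ((A * X) ^ S k) <= INR (2 * A) ^ S k * U).
  { eapply Rle_trans.
    (* Only X - 1 is bounded by a root of [m]; since 2 <= X, passing from X to 2 (X - 1) costs a
       constant factor. *)
    - apply le_INR. apply Nat.pow_le_mono_l with (b := (2 * A * (X - 1))%nat).
      nia.
    - rewrite pow_INR, mult_INR, Rpow_mult_distr.
      apply Rmult_le_compat_l; [apply pow_le, pos_INR|exact HXU]. }
  apply le_INR in HT. rewrite plus_INR, mult_INR, plus_INR, !mult_INR in HT.
  pose proof (pos_INR K1). pose proof (pos_INR K2).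
  assert (HQ0 : 0 <= INR ((A * X) ^ S k)) by apply pos_INR.
  assert (H1 : INR TD + INR K1 * INR m <= (c0 + INR K1) * Y) by nra.
  assert (H2 : INR K2 * INR m <= INR K2 * (U * Y)).
  { apply Rmult_le_compat_l; [trivial|]. nra. }
  assert (H3 : 0 <= INR TD + INR K1 * INR m).
  { pose proof (pos_INR TD). nra. }
  assert (H4 : INR ((A * X) ^ S k) * (INR TD + INR K1 * INR m)
    <= (INR (2 * A) ^ S k * U) * ((c0 + INR K1) * Y))
    by (apply Rmult_le_compat; trivial).
  lra.
Qed.

(** * The reduction *)

(** The hypothesis might name a [k] too small for a cycle of this kind; a program that always
    rejects settles that case. *)
Lemma cycle_detectable_no_cycle h k (f : nat -> R) :
  (k < min_cycle_length h)%nat ->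
  (forall m, (1 <= m)%nat -> 1 <= f m) -> cycle_detectable h k f.
Proof.
  intros Hk Hf. exists 1%nat, [Const 0 0], 1. split; [lia|].
  intros m n E Hm _ _ _. eexists 1%nat, _. split; [|split].
  - eapply halts_step; [reflexivity|]. apply halts_now. reflexivity.
  - rewrite Rmult_1_l. simpl. now apply Hf.
  - cbn [exec_instr reg]. rewrite upd_same, Nat.Div0.mod_0_l.
    split; [lia|]. intros [H _]. lia.
Qed.

Lemma cycle_detectable_of_incremental h g k eps :
  0 < eps ->
  incremental_st_path_solvable g
    (fun m => Rpower (INR m) (2 - eps)) (fun m => Rpower (INR m) (1 - eps)) ->
  cycle_detectable h k (fun m => Rpower (INR m) (2 - Rmin eps 1 / 2)).
Proof.
  intros Heps (c & D & C & Hc & HD).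
  (* The cap at 1 gives 2 - e >= 1, so linear overheads are absorbed by m^(2-e). *)
  set (e := Rmin eps 1).
  assert (He : 0 < e <= 1) by (unfold e, Rmin; destruct (Rle_dec eps 1); lra).
  assert (He' : e <= eps) by apply Rmin_l.
  destruct (Nat.lt_ge_cases k (min_cycle_length h)) as [Hk|Hk].
  { apply cycle_detectable_no_cycle; trivial. intros m Hm.
    apply one_le_Rpower; [|lra]. change 1 with (INR 1). now apply le_INR. }
  assert (Hk2 : (2 <= k)%nat) by (destruct h; simpl in Hk; lia).
  destruct (regs_below_exists (preprocess D)) as [B1 HB1].
  destruct (regs_below_exists (on_insert D)) as [B2 HB2].
  destruct (regs_below_exists (on_query D)) as [B3 HB3].
  set (B := (B1 + B2 + B3 + 4)%nat).
  (* This [L] makes the number of trials, of order m^((k+1)/L), at most of order m^(e/2). *)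
  destruct (INR_unbounded (INR (S k) / (e / 2))) as [L HL].
  assert (HLk : INR (S k) <= e / 2 * INR L).
  { apply Rmult_gt_compat_l with (r := e / 2) in HL; [|lra].
    replace (e / 2 * (INR (S k) / (e / 2))) with (INR (S k)) in HL
      by (field; lra). lra. }
  assert (HL1 : (1 <= L)%nat).
  { destruct L as [|L]; [|lia]. simpl (INR 0) in HLk.
    pose proof (pos_INR k). rewrite S_INR in HLk. lra. }
  remember (S L * (k * k) * fact (S L * (k * k)) + 2)%nat as A eqn:EA.
  (* Here 242 = 90 + 120 + 32 bounds the overhead of a trial, by [n <= 2 * m] and [1 <= m]. *)
  set (K1 := (B + 24 * k + 242)%nat). set (K2 := (200 + L + c + k)%nat).
  (* The factor 600 is 2 for the simulation, 3 from [data_structure_time] and 100 from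
     [Rpower_scale]; the summand 1 pays for rounding up to the natural number [TD]. *)
  set (c0 := 600 * Rabs C + 1).
  exists (outer_word_constant c k L A),
    (compile 0 (main_cmd D B c k h L A)),
    (INR (2 * A) ^ S k * (c0 + INR K1) + INR K2).
  split; [unfold outer_word_constant; lia|].
  intros m n E Hm Hn HE Hlen.
  assert (Hn1 : (1 <= n)%nat).
  { destruct E as [|[u u'] E]; [simpl in Hlen; lia|].
    destruct (proj1 HE u u'); [now left|lia]. }
  assert (Hm1 : 1 <= INR m) by (change 1 with (INR 1); now apply le_INR).
  set (M := (2 * m + 4 * n)%nat).
  assert (Hord : order n E = (5 * n + 3 + 2 * m)%nat) by now rewrite <- Hlen.
  destruct (HD M (order n E) (3 * n)%nat (4 * n + 1)%nat)
    as (T0 & st0 & Hpre & HT0 & Hops); [lia|lia|lia|lia|].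
  assert (HM1 : 1 <= INR M)
    by (change 1 with (INR 1); apply le_INR; unfold M; lia).
  assert (HM10 : INR M <= 10 * INR m).
  { replace 10 with (INR 10) by (simpl; lra). rewrite <- mult_INR.
    apply le_INR. unfold M. lia. }
  set (r := 600 * Rabs C * Rpower (INR m) (2 - e)).
  assert (Hr0 : 0 <= r).
  { unfold r. pose proof (Rabs_pos C). apply Rmult_le_pos; [lra|].
    left; apply exp_pos. }
  destruct (nat_upper Hr0) as (TD & HTD1 & HTD2).
  assert (Hserve : exists T0 st0,
    halts_in (word_size c M) (preprocess D)
      (call blank [order n E; M; (3 * n)%nat; (4 * n + 1)%nat]) T0 st0 /\
    forall col, exists outs T,
      serves (word_size c M) D st0 (layered_ops h n k E col) outs T /\
      correct_answers g (order n E) (3 * n) (4 * n + 1) []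
        (layered_ops h n k E col) outs /\
      (2 * (T0 + T) <= TD)%nat).
  { exists T0, st0. split; [exact Hpre|]. intros col.
    destruct (Hops (layered_ops h n k E col)) as (outs & T & Hs & Hcor & HT).
    - now apply layered_ops_simple.
    - rewrite layered_ops_size, Hlen. reflexivity.
    - exists outs, T. split; [trivial|split; [trivial|]].
      apply INR_le. eapply Rle_trans; [|exact HTD1].
      rewrite mult_INR, plus_INR. simpl (INR 2). unfold r.
      assert (H1 : INR T0 + INR T <= 3 * Rabs C * Rpower (INR M) (2 - e)).
      { eapply data_structure_time with (eps := eps);
          [exact HM1|exact He'| |exact HT0|exact HT].
        split; [apply pos_INR|]. change 2 with (INR 2). rewrite <- mult_INR.
        apply le_INR. rewrite layered_ops_length, Hlen. unfold M. lia. }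
      assert (H2 : Rpower (INR M) (2 - e) <= 100 * Rpower (INR m) (2 - e))
        by (apply Rpower_scale; lra).
      pose proof (Rabs_pos C). nra. }
  pose proof (@wp_main (word_size (outer_word_constant c k L A) m)
    (word_size c M) D B c h g n k L A E TD) as Hmain.
  rewrite Hlen in Hmain.
  destruct (Hmain) with (P := compile 0 (main_cmd D B c k h L A)) (off := 0%nat)
    as (T & rg & mm & Hsteps & Hiff & X & HX & HXL & HT); trivial.
  - unfold B. lia.
  - apply HB1. unfold B. lia.
  - apply HB2. unfold B. lia.
  - apply HB3. unfold B. lia.
  - lia.
  - now apply bound_size.
  - now apply bound_k.
  - now apply bound_A.
  - now apply bound_L.
  - now apply bound_Q.
  - intros i x Hi. exact Hi.
  - exists T, (State (0 + clen (main_cmd D B c k h L A)) rg mm).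
    split; [|split].
    + apply steps_halts; [exact Hsteps|]. apply nth_error_None.
      rewrite compile_length. simpl. lia.
    + apply total_time with (L := L) (X := X) (TD := TD) (m := m); trivial.
      * unfold c0. pose proof (Rabs_pos C). lra.
      * unfold c0. unfold r in *.
        assert (1 <= Rpower (INR m) (2 - e)) by (apply one_le_Rpower; lra). lra.
      * simpl plus in HT. eapply Nat.le_trans; [exact HT|].
        apply Nat.add_le_mono_r, Nat.mul_le_mono_l. unfold trial_cost, K1.
        rewrite Hlen. pose proof (Nat.mul_le_mono_l 1 m B Hm). lia.
    + exact Hiff.
Qed.

Theorem theorem7 (h g : graph_kind) :
  k_cycle_hypothesis h ->
  ~ exists eps : R, (0 < eps)%R /\
      incremental_st_path_solvable g
        (fun m => Rpower (INR m) (2 - eps))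
        (fun m => Rpower (INR m) (1 - eps)).
Proof.
  intros Hhyp (eps & Heps & Hinc).
  (* Half of the capped saving is what remains after paying for the trials. *)
  destruct (Hhyp (Rmin eps 1 / 2)) as [k Hk].
  - unfold Rmin. destruct (Rle_dec eps 1); lra.
  - apply Hk. now apply cycle_detectable_of_incremental with (g := g).
Qed.
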